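(* Let $d\ge 2$ and let $S\subset\mathbb{R}^d$ be a finite set of distinct points with $|S|$ even. For a point $x\in\mathbb{R}^d$, the following two conditions are equivalent: (i) every perfect hyperplane contains $x$; (ii) every line through $x$ is balanced about $x$, and there is a plane $P$ containing all the odd-balanced lines about $x$; if there are no odd-balanced lines about $x$ then $x\notin S$, and if there is at least one odd-balanced line about $x$ then $x\in S$; moreover, if $l_1,\dots,l_k$ are the odd-balanced lines about $x$, labeled and oriented so that, going around $x$ in $P$ in a fixed rotational direction, the open half-lines appear in the order $l_1^+,\dots,l_k^+,l_1^-,\dots,l_k^-$, then $k$ is odd, and either $|l_i^+\cap S|=|l_i^-\cap S|+1$ holds precisely for the odd $i$, or it holds precisely for the even $i$. Alice wins if and only if there exists a point $x\in\mathbb{R}^d$ satisfying these conditions, and in that case $a=x$ is a winning point for Alice.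
   Context: The game: Alice chooses $a\in\mathbb{R}^d$; then Bob, knowing $a$, chooses $b\in\mathbb{R}^d$. With $\rho$ the Euclidean distance, $V_A=|\{y\in S:\rho(a,y)<\rho(b,y)\}|$ and $V_B=|\{y\in S:\rho(b,y)<\rho(a,y)\}|$. A point $a$ is a winning point for Alice if $V_A\ge V_B$ for every $b\in\mathbb{R}^d$; Alice wins if a winning point exists. For an affine hyperplane $H=\{y:\langle y,c\rangle=\lambda\}$ ($c\ne0$) write $H^+=\{y:\langle y,c\rangle>\lambda\}$, $H^-=\{y:\langle y,c\rangle<\lambda\}$. When $|S|$ is even, $H$ is perfect if $|H^+\cap S|<|S|/2$ and $|H^-\cap S|<|S|/2$. For a line $l$ through $x$, $l^+,l^-$ denote the two open half-lines into which $x$ divides $l$; $l$ is balanced about $x$ if $\big||l^+\cap S|-|l^-\cap S|\big|\le1$; it is odd-balanced about $x$ if it is balanced and $|(l\setminus\{x\})\cap S|$ is odd (so one side has exactly one more point of $S$ than the other).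
   Formalization: (i)⇒(ii) is proved only for S empty or not contained in a line: for S={0,e}, x=2e, (i) holds but (ii) fails. (ii)⇒(i) holds for all S; in the last sentence ''these conditions'' means (ii). The ''moreover'' clause is read for k≥1. *)

(* Defs.v *)
From HB Require Import structures.
From mathcomp Require Import all_boot all_order all_algebra.
From mathcomp Require Import finmap.
From mathcomp Require Import boolp classical_sets reals trigo.

Set Implicit Arguments.
Unset Strict Implicit.
Unset Printing Implicit Defensive.

Import Order.TTheory GRing.Theory Num.Theory.
Local Open Scope classical_set_scope.
Local Open Scope ring_scope.

Section Game.
Context {R : realType} {d : nat}.
Notation point := 'rV[R]_d.
Implicit Types (S : {fset point}) (x y a b c u v p : point).

Definition dot u v : R := \sum_(i < d) u 0 i * v 0 i.

(* The library norm on row vectors is the sup norm, hence this definition. *)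
Definition dist x y : R := Num.sqrt (dot (x - y) (x - y)).

Definition npts S (A : set point) : nat := #|` [fset y in S | y \in A]%fset |.

Definition votes_A S a b : nat := npts S [set y | dist a y < dist b y].
Definition votes_B S a b : nat := npts S [set y | dist b y < dist a y].

Definition winning S a : Prop := forall b, (votes_B S a b <= votes_A S a b)%N.
Definition alice_wins S : Prop := exists a, winning S a.

Definition hyperplane c (lam : R) : set point := [set y | dot y c = lam].
Definition hyperplane_pos c (lam : R) : set point := [set y | lam < dot y c].
Definition hyperplane_neg c (lam : R) : set point := [set y | dot y c < lam].

(* [npts < #|S| / 2], with the denominator cleared. *)
Definition perfect S c (lam : R) : Prop :=
  (2 * npts S (hyperplane_pos c lam) < #|` S|)%N /\
  (2 * npts S (hyperplane_neg c lam) < #|` S|)%N.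

Definition perfect_hyperplanes_contain S x : Prop :=
  forall c (lam : R), c != 0 -> perfect S c lam -> hyperplane c lam x.

(* A line through [x] is [line x v] with [v != 0]; the choice of [v] orients
   it, and [l^+], [l^-] are then [halfline x v] and [halfline x (- v)]. *)
Definition line x v : set point := [set x + t *: v | t in [set: R]].
Definition halfline x v : set point := [set x + t *: v | t in [set t : R | 0 < t]].

(* If [S] is nonempty and lies on a line [L], every perfect hyperplane contains
   [L], so [perfect_hyperplanes_contain S] holds on all of [L], whereas
   [balanced_center S] fails on [L] outside the median segment of [S]. *)
Definition collinear S : Prop :=
  exists p v, v != 0 /\ forall y, y \in S -> line p v y.

Definition balanced S x v : Prop :=
  `|(npts S (halfline x v))%:Z - (npts S (halfline x (- v)))%:Z| <= 1.

Definition odd_balanced S x v : Prop :=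
  balanced S x v /\ odd (npts S (line x v `\ x)).

Definition plane p u v : set point :=
  [set z | exists s t : R, z = p + s *: u + t *: v].

Definition is_plane (P : set point) : Prop :=
  exists p u v, row_free (col_mx u v) /\ P = plane p u v.

Definition orthonormal2 u v : Prop := [/\ dot u u = 1, dot v v = 1 & dot u v = 0].

(* Going around [x] in [P] in a fixed rotational direction, the half-lines
   [h 0], ..., [h n.-1] from [x] appear in this order.  The orthonormal frame
   [(u, v)] of [P] fixes the direction of rotation, and the polar angles
   increase within a single full turn. *)
Definition appear_in_order (P : set point) x n (h : 'I_n -> set point) : Prop :=
  exists u v, [/\ orthonormal2 u v, P = plane x u v &
  exists theta : 'I_n -> R,
    [/\ forall i j : 'I_n, (i < j)%N -> theta i < theta j,
        forall i j : 'I_n, theta j < theta i + 2 * pi &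
        forall i, h i = halfline x (cos (theta i) *: u + sin (theta i) *: v)]].

(* [l_1^+, ..., l_k^+, l_1^-, ..., l_k^-] for the lines directed by [e]. *)
Definition plus_then_minus x k (e : 'I_k -> point) (i : 'I_(k + k)) : set point :=
  match split i with
  | inl j => halfline x (e j)
  | inr j => halfline x (- e j)
  end.

(* [e] lists every odd-balanced line about [x] exactly once, oriented. *)
Definition odd_balanced_labeling S x k (e : 'I_k -> point) : Prop :=
  [/\ forall i, e i != 0 /\ odd_balanced S x (e i),
      injective (fun i => line x (e i)) &
      forall v, v != 0 -> odd_balanced S x v ->
        exists i, line x v = line x (e i)].

(* The index [i : 'I_k] stands for the label [i.+1] in [1, ..., k]. *)
Definition alternating_surplus S x k (e : 'I_k -> point) : Prop :=
  (forall i : 'I_k,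
     npts S (halfline x (e i)) = (npts S (halfline x (- e i)) + 1)%N
     <-> odd i.+1) \/
  (forall i : 'I_k,
     npts S (halfline x (e i)) = (npts S (halfline x (- e i)) + 1)%N
     <-> ~~ odd i.+1).

(* The last clause is about [k >= 1]: with no odd-balanced line, [k = 0] would
   contradict [odd k]. *)
Definition balanced_center S x : Prop :=
  (forall v, v != 0 -> balanced S x v) /\
  exists P : set point,
  [/\ is_plane P,
      forall v, v != 0 -> odd_balanced S x v -> line x v `<=` P,
      ~ (exists v, v != 0 /\ odd_balanced S x v) -> x \notin S,
      (exists v, v != 0 /\ odd_balanced S x v) -> x \in S &
      forall k (e : 'I_k -> point), (0 < k)%N ->
        odd_balanced_labeling S x e ->
        appear_in_order P x (plus_then_minus x e) ->
        odd k /\ alternating_surplus S x e].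

End Game.

(* Main.v *)
Require Import Defs.
From mathcomp Require Import all_boot all_order all_algebra.
From mathcomp Require Import finmap.
From mathcomp Require Import boolp classical_sets reals trigo.
From mathcomp Require Import ring lra zify.

(* Put x at the origin.  A bisector of x and b can be pushed towards x, so x wins
   iff x has halfspace depth at least |S|/2 in S ([deep]).  Pairing points on
   lines through x, the imbalance of S across a hyperplane through x is the sum
   of the signs of the surplus directions of the odd-balanced lines; depth
   forces that sum to be at most 1 in absolute value for generic hyperplanes.
   Tilting a hyperplane through two odd-balanced lines shows that their plane
   contains a third one, so by Sylvester-Gallai all of them are coplanar, and
   rotating a line of that plane about x shows that the surpluses alternate.
   Conversely an alternating sum of an odd number of monotone signs lies in
   [-1, 1].

   If x is not deep, some direction c has more than half of S strictly on its
   positive side.  Turning c in a plane until the upper half of S first touches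
   the lower half gives, in the two senses of rotation, two perfect
   hyperplanes; if both contain x, they coincide and contain S, and the plane of
   rotation can be chosen to exclude this unless S is collinear. *)

Set Implicit Arguments.
Unset Strict Implicit.
Unset Printing Implicit Defensive.

Import Order.TTheory GRing.Theory Num.Theory.
Local Open Scope ring_scope.


(** * Inner product, perturbation and general position *)

Section Dot.
Context {R : realType} {d : nat}.
Implicit Types (u v w : 'rV[R]_d) (a : R).

Lemma dotE u v : dot u v = (u *m v^T) 0 0.
Proof. by rewrite mxE; apply: eq_bigr => i _; rewrite mxE. Qed.

Lemma dotC u v : dot u v = dot v u.
Proof. by apply: eq_bigr => i _; rewrite mulrC. Qed.

Lemma dotDl u v w : dot (u + v) w = dot u w + dot v w.
Proof. by rewrite !dotE mulmxDl mxE. Qed.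

Lemma dotZl a u w : dot (a *: u) w = a * dot u w.
Proof. by rewrite !dotE -scalemxAl mxE. Qed.

Lemma dotNl u w : dot (- u) w = - dot u w.
Proof. by rewrite -scaleN1r dotZl mulN1r. Qed.

Lemma dotBl u v w : dot (u - v) w = dot u w - dot v w.
Proof. by rewrite dotDl dotNl. Qed.

Lemma dotDr u v w : dot w (u + v) = dot w u + dot w v.
Proof. by rewrite !(dotC w) dotDl. Qed.

Lemma dotZr a u w : dot w (a *: u) = a * dot w u.
Proof. by rewrite !(dotC w) dotZl. Qed.

Lemma dotNr u w : dot w (- u) = - dot w u.
Proof. by rewrite !(dotC w) dotNl. Qed.

Lemma dotBr u v w : dot w (u - v) = dot w u - dot w v.
Proof. by rewrite !(dotC w) dotBl. Qed.

Lemma dot0l u : dot 0 u = 0.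
Proof. by rewrite -(scale0r 0) dotZl mul0r. Qed.

Lemma dot0r u : dot u 0 = 0.
Proof. by rewrite dotC dot0l. Qed.

Definition dot_lin := (dotDl, dotDr, dotBl, dotBr, dotZl, dotZr, dotNl, dotNr).

Lemma dot_ge0 u : 0 <= dot u u.
Proof. by apply: sumr_ge0 => i _; rewrite -expr2 sqr_ge0. Qed.

Lemma dot_eq0 u : (dot u u == 0) = (u == 0).
Proof.
apply/idP/eqP => [|->]; last by rewrite dot0l.
rewrite psumr_eq0 => [/allP h|i _]; last by rewrite -expr2 sqr_ge0.
apply/rowP => i; rewrite mxE.
by have := h i (mem_index_enum i); rewrite mulf_eq0 orbb => /eqP.
Qed.

Lemma dot_gt0 u : (0 < dot u u) = (u != 0).
Proof. by rewrite lt0r dot_ge0 andbT dot_eq0. Qed.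

Lemma dot_mx_eq0 m (A : 'M[R]_(m, d)) (q : 'rV_d) : ~~ (q <= A)%MS ->
  exists c, (forall a : 'rV_d, (a <= A)%MS -> dot c a = 0) /\ dot c q != 0.
Proof.
rewrite submxE => /rV0Pn[j qj].
exists (col j (cokermx A))^T; split.
  move=> a /submxP[b ->]; rewrite dotC dotE trmxK colE mulmxA -(mulmxA b).
  by rewrite mulmx_coker mulmx0 mul0mx mxE.
by rewrite dotC dotE trmxK colE mulmxA -colE mxE.
Qed.

(** Tilting a direction slightly makes it generic while its signs stay known. Each vector of [Q]
    bounds [eps] separately, and finitely many bounds have a positive minimum. *)
Lemma sg_perturb (Q : seq 'rV[R]_d) c w :
  exists2 eps, 0 < eps & forall q, q \in Q ->
    Num.sg (dot (c + eps *: w) q) =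
    if dot c q == 0 then Num.sg (dot w q) else Num.sg (dot c q).
Proof.
suff [e0 e0_gt0 H] : exists2 e0, 0 < e0 & forall eps q, 0 < eps <= e0 ->
    q \in Q -> Num.sg (dot (c + eps *: w) q) =
    if dot c q == 0 then Num.sg (dot w q) else Num.sg (dot c q).
  by exists e0 => // q; apply: H; rewrite e0_gt0 lexx.
elim: Q => [|q Q [e1 e1_gt0 IH]]; first by exists 1.
have [e2 e2_gt0 H2] : exists2 e2, 0 < e2 & forall eps, 0 < eps <= e2 ->
    Num.sg (dot (c + eps *: w) q) =
    if dot c q == 0 then Num.sg (dot w q) else Num.sg (dot c q).
  have [cq|cq] := eqVneq (dot c q) 0.
    exists 1 => // eps /andP[eps0 _].
    by rewrite dot_lin dotZl cq add0r sgrM gtr0_sg ?mul1r.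
  have w1 : 0 < `|dot w q| + 1 by rewrite ltr_wpDl.
  exists (`|dot c q| / (`|dot w q| + 1)).
    by rewrite divr_gt0 ?normr_gt0.
  move=> eps /andP[eps0]; rewrite ler_pdivlMr // => epsle.
  have : `|eps * dot w q| < `|dot c q|.
    by rewrite normrM (gtr0_norm eps0); nra.
  rewrite dotDl dotZl; move: (eps * _) => t.
  have [c0|c0|] := ltrgtP (dot c q) 0; last by move/eqP: cq.
    rewrite (ltr0_norm c0) ltr_norml => /andP[t1 t2].
    by rewrite !ltr0_sg //; lra.
  rewrite (gtr0_norm c0) ltr_norml => /andP[t1 t2].
  by rewrite !gtr0_sg //; lra.
exists (Num.min e1 e2); first by rewrite lt_min e1_gt0.
move=> eps q'; rewrite le_min => /and3P[eps0 eps1 eps2].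
rewrite inE => /predU1P[->|]; first by rewrite H2 // eps0.
by apply: IH; rewrite eps0.
Qed.

(** Induction on [Q]: a vector orthogonal to [A] but not to the new [q] is added with a coefficient
    so small that the products already nonzero keep their signs. *)
Lemma generic_orthogonal m (A : 'M[R]_(m, d)) (Q : seq 'rV[R]_d) :
    (forall q, q \in Q -> ~~ (q <= A)%MS) ->
  exists c, (forall a : 'rV_d, (a <= A)%MS -> dot c a = 0) /\
    forall q, q \in Q -> dot c q != 0.
Proof.
elim: Q => [|q Q IH] H.
  by exists 0; split=> // a _; rewrite dot0l.
have [|c [cA cQ]] := IH; first by move=> q' q'Q; rewrite H // inE q'Q orbT.
have [w [wA wq]] := dot_mx_eq0 (H q (mem_head _ _)).
have [eps _ epsP] := sg_perturb (q :: Q) c w.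
exists (c + eps *: w); split=> [a aA|q' q'Q].
  by rewrite dotDl dotZl cA // wA // mulr0 addr0.
rewrite -sgr_eq0 epsP //; case: ifPn => [|cq']; last by rewrite sgr_eq0.
move: q'Q; rewrite inE => /predU1P[-> _|/cQ /negPf-> //].
by rewrite sgr_eq0.
Qed.

Lemma generic_dot (Q : seq 'rV[R]_d) :
  (forall q, q \in Q -> q != 0) -> exists c, forall q, q \in Q -> dot c q != 0.
Proof.
move=> Q0; have [|c [_ cQ]] := @generic_orthogonal d 0 Q; last by exists c.
by move=> q /Q0; rewrite submx0.
Qed.

(** Removing the projection on [w] leaves a vector whose squared length, the squared distance from
    [u] to the line of [w], is a Gram determinant over [dot w w]. *)
Lemma dot_proj u w (r := dot u w / dot w w) : w != 0 ->
  dot (u - r *: w) w = 0 /\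
  dot (u - r *: w) (u - r *: w) =
    (dot u u * dot w w - dot u w ^+ 2) / dot w w.
Proof.
rewrite -dot_gt0 => /lt0r_neq0 w0; rewrite /r; split.
  by rewrite !dot_lin divfK // subrr.
by rewrite !dot_lin (dotC w u); field.
Qed.

(* Equality case of Cauchy-Schwarz *)
Lemma gram_gt0 u w : w != 0 ->
  ~ (exists t, u = t *: w) -> 0 < dot u u * dot w w - dot u w ^+ 2.
Proof.
move=> w0 uw; have [_] := dot_proj u w0; move: w0; rewrite -dot_gt0 => w0 E.
suff : 0 < (dot u u * dot w w - dot u w ^+ 2) / dot w w.
  by rewrite pmulr_lgt0 ?invr_gt0.
rewrite -E dot_gt0 subr_eq0; apply/eqP => u_w; apply: uw.
by exists (dot u w / dot w w).
Qed.

End Dot.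

(** * The Sylvester-Gallai theorem *)

Section SylvesterGallai.
Context {R : realType} {d : nat} {T : finType}.
Variable y : T -> 'rV[R]_d.

(* Kelly's argument: among the pairs of a point and a line that misses it,
   take one at minimal distance. *)
Lemma sylvester_gallai : injective y ->
    (forall a b, a != b -> exists c, [/\ c != a, c != b &
       exists t, y c = y a + t *: (y b - y a)]) ->
  forall a b p, a != b -> exists t, y p = y a + t *: (y b - y a).
Proof.
move=> yI third a0 b0 p0 ab0; apply: contrapT => bad0.
(* For [i = (p, a, b)] the Gram determinant [G i] is positive iff the three points are not
   collinear, and then [G i / L i] is the squared distance from [y p] to the line through [y a] and
   [y b]. *)
pose G (i : T * T * T) := let u := y i.1.1 - y i.1.2 in
  let w := y i.2 - y i.1.2 in dot u u * dot w w - dot u w ^+ 2.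
pose L (i : T * T * T) := let w := y i.2 - y i.1.2 in dot w w.
have G0 : 0 < G (p0, a0, b0).
  apply: gram_gt0; first by rewrite subr_eq0 (inj_eq yI) eq_sym.
  by move=> [t Et]; apply: bad0; exists t; rewrite -Et addrC subrK.
case: (@arg_minP _ _ _ (p0, a0, b0) (fun i => 0 < G i) (fun i => G i / L i) G0).
move=> [[p a] b] Gpab minG.
have L_gt0 : 0 < L (p, a, b).
  rewrite dot_gt0; apply/eqP => /= E; move: Gpab.
  by rewrite /G /= E !dot0r mulr0 expr0n subrr ltxx.
have ab : a != b.
  by apply/eqP => E; move: L_gt0; rewrite /L /= E subrr dot0l ltxx.
have [w Ew] : exists w, w = y b - y a by exists (y b - y a).
have w_gt0 : 0 < dot w w by rewrite Ew.
pose n := G (p, a, b) / L (p, a, b).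
have [c [ca cb [t]]] := third a b ab; rewrite -Ew => Et.
have n_gt0 : 0 < n by rewrite divr_gt0.
have [r [q [Eq qw qq]]] : exists r q,
    [/\ q = y p - y a - r *: w, dot q w = 0 & dot q q = n].
  have w0 : w != 0 by rewrite -dot_gt0.
  have [qw qq] := dot_proj (y p - y a) w0.
  exists (dot (y p - y a) w / dot w w), (y p - y a - (dot (y p - y a) w / dot w w) *: w).
  by split=> //; rewrite qq Ew.
(* The foot of the perpendicular from [y p] has parameter [r]. Of two points on the same closed side
   of it, the nearer one would be too close to the line through [y p] and the other, against
   minimality. *)
have key i j s1 s2 : y i = y a + s1 *: w -> y j = y a + s2 *: w -> s1 != s2 ->
    (s1 - r) ^+ 2 <= (s2 - r) ^+ 2 -> (s1 - r) * (s2 - r) < 0.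
  move=> Ei Ej s12 le12; rewrite ltNge; apply/negP => ge0.
  have Eip : y i - y p = (s1 - r) *: w - q.
    by rewrite Ei Eq; apply/rowP => l; rewrite !mxE; ring.
  have Ejp : y j - y p = (s2 - r) *: w - q.
    by rewrite Ej Eq; apply/rowP => l; rewrite !mxE; ring.
  move: s12 ge0 le12; rewrite -(inj_eq (addIr (- r))) => s12.
  move: Eip Ejp s12; set al := s1 - r; set be := s2 - r => Eip Ejp s12 ge0 le12.
  have EG : G (i, p, j) = n * dot w w * (al - be) ^+ 2.
    by rewrite /G /= Eip Ejp !dot_lin qw (dotC w q) qw qq; ring.
  have EL : L (i, p, j) = be ^+ 2 * dot w w + n.
    by rewrite /L /= Ejp !dot_lin qw (dotC w q) qw qq; ring.
  have G_gt0 : 0 < G (i, p, j).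
    rewrite EG; apply: mulr_gt0; first exact: mulr_gt0.
    by rewrite exprn_even_gt0 //= subr_eq0.
  have L0 : 0 < L (i, p, j).
    by rewrite EL ltr_wpDl // mulr_ge0 ?sqr_ge0 // ltW.
  have := minG _ G_gt0; rewrite -/n; apply/negP; rewrite -ltNge.
  rewrite ltr_pdivrMr // EG EL -mulrA ltr_pM2l //.
  have le : (al - be) ^+ 2 <= be ^+ 2.
    have [->|al0] := eqVneq al 0; first by rewrite sub0r sqrrN.
    have [be0|be0] := eqVneq be 0; first by move: le12; rewrite be0; nra.
    nra.
  by rewrite [ltLHS]mulrC ltr_pwDr // ler_wpM2r // ltW.
have pair i j s1 s2 : y i = y a + s1 *: w -> y j = y a + s2 *: w -> s1 != s2 ->
    (s1 - r) * (s2 - r) < 0.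
  move=> Ei Ej s12; have [le12|/ltW le21] := leP ((s1 - r) ^+ 2) ((s2 - r) ^+ 2).
    exact: (key i j).
  by rewrite mulrC; apply: (key j i) => //; rewrite eq_sym.
have Ea : y a = y a + 0 *: w by rewrite scale0r addr0.
have Eb : y b = y a + 1 *: w by rewrite scale1r Ew addrC subrK.
have t0 : 0 != t.
  by apply: contraNneq ca => t0; apply/eqP/yI; rewrite Et -t0 scale0r addr0.
have t1 : 1 != t.
  by apply: contraNneq cb => t1; apply/eqP/yI; rewrite Et -t1 scale1r Ew addrC subrK.
have z1 : (0 : R) != 1 by rewrite eq_sym oner_neq0.
(* The parameters are 0, 1 and [t]; three reals cannot have pairwise negative products. *)
have h1 := pair _ _ _ _ Ea Eb z1; have h2 := pair _ _ _ _ Ea Et t0.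
have h3 := pair _ _ _ _ Eb Et t1.
nra.
Qed.

End SylvesterGallai.


(** * Depth, surpluses of lines, and coplanarity of the odd lines *)

Section Family.
Context {R : realType} {d : nat} {T : finType}.
Variable p : T -> 'rV[R]_d.
Implicit Types (c u v w : 'rV[R]_d).

Definition imbalance c : R := \sum_y Num.sg (dot c (p y)).
Definition num_orthogonal c : R := \sum_y (dot c (p y) == 0)%:R.
(** When [p] lists the vectors from [x] to the points of [S], this is 1 or 0 according as [x] is in
    [S]. *)
Definition num_zero : R := \sum_y (p y == 0)%:R.
(** Halfspace depth: no open halfspace bounded by a hyperplane through the origin contains more than
    half of the vectors. *)
Definition deep : Prop := forall c, imbalance c <= num_orthogonal c.
Definition surplus v : R := \sum_(y | (p y <= v)%MS) Num.sg (dot v (p y)).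

Lemma sg_dot_line c q v : (q <= v)%MS ->
  Num.sg (dot c q) = Num.sg (dot c v) * Num.sg (dot v q).
Proof.
move=> /sub_rVP[t ->]; rewrite !dotZr !sgrM mulrCA; congr (_ * _).
have [->|v0] := eqVneq v 0; first by rewrite dot0r sgr0 mul0r.
by rewrite (@gtr0_sg _ (dot v v)) ?mulr1 // dot_gt0.
Qed.

Lemma line_sym u v : u != 0 -> (u <= v)%MS -> (v <= u)%MS.
Proof.
move=> u0 /sub_rVP[t ut]; apply/sub_rVP; exists t^-1.
rewrite ut scalerA mulVf ?scale1r //.
by apply: contraNneq u0 => t0; rewrite ut t0 scale0r.
Qed.

Lemma dot_line_neq0 u v : u != 0 -> (u <= v)%MS -> dot v u != 0.
Proof.
move=> u0 uv; rewrite -sgr_eq0; apply: contraNneq u0 => vu.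
by rewrite -dot_eq0 -sgr_eq0 (sg_dot_line u uv) vu mulr0.
Qed.

Lemma sum_sg_line c v :
  \sum_(y | (p y <= v)%MS) Num.sg (dot c (p y)) = Num.sg (dot c v) * surplus v.
Proof. by rewrite mulr_sumr; apply: eq_bigr => y /(sg_dot_line c). Qed.

Lemma surplus_line u v : u != 0 -> (u <= v)%MS ->
  surplus u = Num.sg (dot u v) * surplus v.
Proof.
move=> u0 uv; rewrite -sum_sg_line; apply: eq_bigl => y.
apply/idP/idP => [yu|yv]; first exact: submx_trans uv.
exact: submx_trans (line_sym u0 uv).
Qed.

Lemma surplus_line_eq0 u v : u != 0 -> (u <= v)%MS ->
  (surplus u == 0) = (surplus v == 0).
Proof.
move=> u0 uv; rewrite (surplus_line u0 uv) mulf_eq0 sgr_eq0 dotC.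
by rewrite (negPf (dot_line_neq0 u0 uv)).
Qed.

(* Each term is averaged over the line through it, and the two sums are
   exchanged. *)
Lemma balanced_lines_cancel c :
  \sum_(y | (p y != 0) && (surplus (p y) == 0)) Num.sg (dot c (p y)) = 0.
Proof.
pose H y := (p y != 0) && (surplus (p y) == 0).
pose n y : R := \sum_(z | H z && (p z <= p y)%MS) 1.
have HE y z : H y -> H z && (p z <= p y)%MS = H z && (p y <= p z)%MS.
  by move=> /andP[y0 _]; apply: andb_id2l => /andP[z0 _];
    apply/idP/idP; apply: line_sym.
have n_neq0 y : H y -> n y != 0.
  move=> Hy; rewrite /n (bigD1 y) /=; last by rewrite Hy submx_refl.
  by rewrite lt0r_neq0 // ltr_wpDr // sumr_ge0.
have nE y z : H y -> H z -> (p z <= p y)%MS -> n z = n y.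
  move=> Hy Hz zy; apply: eq_bigl => t; apply: andb_id2l => Ht.
  have yz : (p y <= p z)%MS by apply: line_sym zy; case/andP: Hz.
  by apply/idP/idP => /submx_trans; apply.
transitivity (\sum_(y | H y) \sum_(z | H z && (p z <= p y)%MS)
                Num.sg (dot c (p y)) / n y).
  apply: eq_bigr => y Hy; rewrite -{1}(divfK (n_neq0 _ Hy) (Num.sg _)).
  by rewrite [RHS](eq_bigr (fun=> Num.sg (dot c (p y)) / n y * 1)) ?mulr_sumr //
    => z; rewrite mulr1.
rewrite (exchange_big_dep H) /=; last by move=> y z _ /andP[].
apply: big1 => z Hz.
rewrite (eq_bigl (fun y => H y && (p y <= p z)%MS)); last first.
  move=> y; case Hy: (H y) => //=; rewrite Hz /=.
  by have := HE y z Hy; rewrite Hz.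
rewrite (eq_bigr (fun y => Num.sg (dot c (p y)) / n z)); last first.
  by move=> y /andP[Hy yz]; rewrite (nE z y).
rewrite -mulr_suml.
rewrite (eq_bigl (fun y => (p y <= p z)%MS && (p y != 0))); last first.
  move=> y; rewrite andbC; apply: andb_id2l => yz; rewrite /H.
  case: (boolP (p y != 0)) => //= y0.
  by rewrite (surplus_line_eq0 y0 yz); case/andP: Hz.
rewrite big_mkcondr /= (eq_bigr (fun y => Num.sg (dot c (p y)))); last first.
  by move=> y _; case: eqP => // ->; rewrite dot0r sgr0.
by rewrite sum_sg_line; case/andP: Hz => _ /eqP->; rewrite mulr0 mul0r.
Qed.

(** When all lines are balanced, this is what [odd_balanced_labeling] asks for: a balanced line is
    odd exactly when its surplus is nonzero. *)
Definition labels_odd_lines (I : finType) (e : I -> 'rV[R]_d) : Prop :=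
  [/\ forall i, e i != 0 /\ surplus (e i) != 0,
      forall i j, (e i <= e j)%MS -> i = j &
      forall v, v != 0 -> surplus v != 0 -> exists i, (v <= e i)%MS].

(** Vectors on lines of surplus 0 cancel. Every other nonzero vector lies on the line of exactly one
    label, and that line contributes its surplus with the sign of [dot c (e i)]. *)
Lemma imbalanceE (I : finType) (e : I -> 'rV[R]_d) c : labels_odd_lines e ->
  imbalance c = \sum_i surplus (e i) * Num.sg (dot c (e i)).
Proof.
move=> [e0 eI eS].
rewrite /imbalance (bigID (fun y => (p y != 0) && (surplus (p y) == 0))) /=.
rewrite balanced_lines_cancel add0r.
under [RHS]eq_bigr do rewrite mulrC -sum_sg_line.
rewrite (exchange_big_dep predT) //= big_mkcond; apply: eq_bigr => y _.
have [->|y0] := eqVneq (p y) 0; first by rewrite dot0r sgr0 big1 ?if_same.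
have [y_even|y_odd] /= := eqVneq (surplus (p y)) 0.
  rewrite big_pred0 // => i; apply/negP => yi.
  by have [_ /negP] := e0 i; apply; rewrite -(surplus_line_eq0 y0 yi) y_even.
have [i yi] := eS _ y0 y_odd.
rewrite (big_pred1 i) // => j; apply/idP/eqP => [yj|-> //].
apply: eI; exact: submx_trans (line_sym y0 yj) yi.
Qed.

(* [nz_row <<v>>] depends only on the line spanned by [v]. *)
Lemma odd_lines_labeling : exists k (e : 'I_k -> 'rV[R]_d), labels_odd_lines e.
Proof.
pose f v : 'rV[R]_d := nz_row <<v>>%MS.
have f_sub v : (f v <= v)%MS by rewrite (submx_trans (nz_row_sub _)) ?genmxE.
have f_eq0 v : (f v == 0) = (v == 0).
  by rewrite nz_row_eq0 -!mxrank_eq0 genmxE.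
pose E := undup [seq f (p y) | y <- enum T & (p y != 0) && (surplus (p y) != 0)].
have EP v : v \in E -> exists y, [/\ v = f (p y), p y != 0 & surplus (p y) != 0].
  by rewrite mem_undup => /mapP[y]; rewrite mem_filter => /andP[/andP[]];
    exists y.
exists (size E), (tnth (in_tuple E)); split.
- move=> i; have [y [-> y0 yodd]] := EP _ (mem_tnth i (in_tuple E)).
  by rewrite f_eq0 y0 (surplus_line_eq0 _ (f_sub _)) ?f_eq0.
- move=> i j ij; apply/eqP.
  rewrite -(inj_eq (tuple_uniqP _ (undup_uniq _ : uniq (in_tuple E)))).
  have [y [Ey y0 _]] := EP _ (mem_tnth i (in_tuple E)).
  have [z [Ez z0 _]] := EP _ (mem_tnth j (in_tuple E)).
  move: ij; rewrite Ey Ez => ij; rewrite /f; apply/eqP; congr nz_row.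
  apply/genmxP/andP; split.
  have yf : (p y <= f (p y))%MS by rewrite line_sym ?f_eq0.
    exact: submx_trans yf (submx_trans ij _).
  have /submx_trans : (p z <= f (p z))%MS by rewrite line_sym ?f_eq0.
  by apply; apply: submx_trans (f_sub _); apply: line_sym; rewrite ?f_eq0.
- move=> v v0 vodd; have [y yv y0] : exists2 y, (p y <= v)%MS & p y != 0.
    apply: contrapT => noy; move/eqP: vodd; apply; apply: big1 => y yv.
    by have [->|y0] := eqVneq (p y) 0; [rewrite dot0r sgr0 | case: noy; exists y].
  have : f (p y) \in E.
    rewrite mem_undup; apply/mapP; exists y => //.
    by rewrite mem_filter mem_enum y0 (surplus_line_eq0 y0 yv) vodd.
  move=> /(tnthP (in_tuple E))[i Ei]; exists i; rewrite -Ei.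
  by rewrite (submx_trans (line_sym y0 yv)) // line_sym ?f_eq0.
Qed.

Lemma num_orthogonal_generic c : (forall y, p y != 0 -> dot c (p y) != 0) ->
  num_orthogonal c = num_zero.
Proof.
move=> cp; apply: eq_bigr => y _; congr (nat_of_bool _)%:R.
have [->|/cp/negPf//] := eqVneq (p y) 0.
by rewrite dot0r eqxx.
Qed.

(** A generic [c] orthogonal to [v], tilted towards [v] or [- v], makes the line contribute
    [surplus v] or its opposite, and the other vectors a fixed sum, which [- c] reverses. The four
    resulting bounds are combined. *)
Lemma deep_surplus v : deep -> v != 0 -> `|surplus v| <= num_zero.
Proof.
move=> dp; pose Q := [seq p y | y <- enum T & ~~ (p y <= v)%MS].
have QP y : ~~ (p y <= v)%MS -> p y \in Q.
  by move=> yv; rewrite map_f // mem_filter yv mem_enum.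
have half w c : w != 0 -> (w == v) || (w == - v) ->
    (forall a : 'rV_d, (a <= v)%MS -> dot c a = 0) ->
    (forall q, q \in Q -> dot c q != 0) ->
    surplus w + \sum_(y | ~~ (p y <= v)%MS) Num.sg (dot c (p y)) <= num_zero.
  move=> w0 wv cv cQ.
  have wvE y : (p y <= w)%MS = (p y <= v)%MS.
    by case/orP: wv => /eqP-> //; rewrite (eqmx_opp v).
  have [eps _ epsP] := sg_perturb [seq p y | y <- enum T] c w.
  have {}epsP y := epsP _ (map_f p (mem_enum T y)).
  rewrite -(@num_orthogonal_generic (c + eps *: w)); last first.
    move=> y y0; rewrite -sgr_eq0 epsP; have [yv|yv] := boolP (p y <= v)%MS.
      by rewrite cv // eqxx sgr_eq0 dot_line_neq0 // wvE.
    by rewrite (negPf (cQ _ (QP _ yv))) sgr_eq0 cQ // QP.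
  apply: le_trans (dp _); rewrite /imbalance.
  rewrite [leRHS](bigID (fun y => (p y <= v)%MS)) /= le_eqVlt; apply/orP; left.
  apply/eqP; congr (_ + _).
    rewrite /surplus (eq_bigl _ _ wvE); apply: eq_bigr => y yv.
    by rewrite epsP cv // eqxx.
  by apply: eq_bigr => y yv; rewrite epsP (negPf (cQ _ (QP _ yv))).
move=> v0; have [q|c [cv cQ]] := @generic_orthogonal _ _ _ v Q.
  by move=> /mapP[y]; rewrite mem_filter => /andP[yv _] ->.
have Ncv a : (a <= v)%MS -> dot (- c) a = 0 by move=> /cv; rewrite dotNl => ->; rewrite oppr0.
have NcQ q : q \in Q -> dot (- c) q != 0 by rewrite dotNl oppr_eq0; apply: cQ.
have Nv0 : - v != 0 by rewrite oppr_eq0.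
have vv : (v == v) || (v == - v) by rewrite eqxx.
have vNv : (- v == v) || (- v == - v) by rewrite eqxx orbT.
have := half _ _ v0 vv cv cQ; have := half _ _ v0 vv Ncv NcQ.
have := half _ _ Nv0 vNv cv cQ; have := half _ _ Nv0 vNv Ncv NcQ.
have -> : surplus (- v) = - surplus v.
  rewrite (@surplus_line _ v) // ?(eqmx_opp v) //.
  by rewrite dotNl ltr0_sg ?mulN1r // oppr_lt0 dot_gt0.
under eq_bigr do rewrite dotNl sgrN; rewrite sumrN.
by rewrite ler_norml => *; apply/andP; split; lra.
Qed.

(** As [c] may be orthogonal to vectors on lines without label, it is tilted until only zero vectors
    are orthogonal to it; the labels keep their signs. The lower bound comes from [- c]. *)
Lemma deep_labeling_le (I : finType) (e : I -> 'rV[R]_d) c :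
    deep -> labels_odd_lines e -> (forall i, dot c (e i) != 0) ->
  `|\sum_i surplus (e i) * Num.sg (dot c (e i))| <= num_zero.
Proof.
move=> dp eP; have half c' : (forall i, dot c' (e i) != 0) ->
    \sum_i surplus (e i) * Num.sg (dot c' (e i)) <= num_zero.
  move=> ce; have [q|w wp] := @generic_dot R d [seq p y | y <- enum T & p y != 0].
    by move=> /mapP[y]; rewrite mem_filter => /andP[y0 _] ->.
  have {}wp y : p y != 0 -> dot w (p y) != 0.
    by move=> y0; apply: wp; rewrite map_f // mem_filter y0 mem_enum.
  have [eps _ epsP] := sg_perturb ([seq p y | y <- enum T] ++
    [seq e i | i <- enum I]) c' w.
  rewrite -(@num_orthogonal_generic (c' + eps *: w)); last first.
    move=> y y0; rewrite -sgr_eq0 epsP; last by rewrite mem_cat map_f ?mem_enum.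
    by case: ifPn => cy; rewrite sgr_eq0 // wp.
  apply: le_trans (dp _); rewrite (imbalanceE _ eP) le_eqVlt.
  apply/orP; left; apply/eqP; apply: eq_bigr => i _.
  by rewrite epsP ?(negPf (ce i)) // mem_cat map_f ?orbT ?mem_enum.
move=> ce; rewrite ler_norml half // andbT lerNl -sumrN.
have := half (- c); under eq_bigr do rewrite dotNl sgrN mulrN.
by apply=> i; rewrite dotNl oppr_eq0.
Qed.

Lemma surplus_count v :
  surplus v = #|[pred y | (p y <= v)%MS && (0 < dot v (p y))]|%:R -
              #|[pred y | (p y <= v)%MS && (dot v (p y) < 0)]|%:R.
Proof.
rewrite -!sum1_card !natr_sum [X in X - _]big_mkcond [X in _ - X]big_mkcond.
rewrite -sumrB /surplus big_mkcond; apply: eq_bigr => y _; rewrite !inE.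
case: (_ <= _)%MS => /=; last by rewrite subrr.
case: ltrgt0P => [c0|c0|->]; last by rewrite sgr0 subrr.
  by rewrite gtr0_sg // subr0.
by rewrite ltr0_sg // sub0r.
Qed.

Lemma surplus_int v : surplus v \is a Num.int.
Proof. by rewrite surplus_count rpredB // natr_int. Qed.

Lemma surplus_norm_ge1 v : surplus v != 0 -> 1 <= `|surplus v|.
Proof. by move=> ?; rewrite norm_intr_ge1 // surplus_int. Qed.

(* If no other label were in the span of [e i] and [e j], some [c] orthogonal
   to both could be tilted to have all four sign patterns on them. *)
Lemma third_label_in_span (I : finType) (e : I -> 'rV[R]_d) i j :
    deep -> num_zero <= 1 -> labels_odd_lines e -> i != j ->
  exists l, [/\ l != i, l != j & (e l <= col_mx (e i) (e j))%MS].
Proof.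
move=> dp z1 eP ij; apply: contrapT => noe.
have [e0 eI _] := eP.
have sgD l : surplus (e l) * Num.sg (surplus (e l)) = `|surplus (e l)|.
  by rewrite mulrC -normrEsg.
pose O l := (l != i) && (l != j).
have [q|c [cij cQ]] := @generic_orthogonal _ _ _ (col_mx (e i) (e j))
    [seq e l | l <- enum I & O l].
  move=> /mapP[l]; rewrite mem_filter => /andP[/andP[li lj] _] ->.
  by apply/negP => lij; apply: noe; exists l.
have {}cQ l : O l -> dot c (e l) != 0.
  by move=> Ol; apply: cQ; rewrite map_f // mem_filter Ol mem_enum.
have ci : dot c (e i) = 0.
  by apply: cij; apply: submx_trans (submx_refl _) _; rewrite -addsmxE addsmxSl.
have cj : dot c (e j) = 0.
  by apply: cij; rewrite -addsmxE addsmxSr.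
have [|wi [wij wii]] := @dot_mx_eq0 _ _ _ (e j) (e i).
  by apply: contra_neqN ij => /eI.
have [|wj [wji wjj]] := @dot_mx_eq0 _ _ _ (e i) (e j).
  by apply: contra_neqN ij => /eI ->.
pose t l := Num.sg (surplus (e l)).
(* The coefficients give [dot w] the sign of the surplus at both [e i] and [e j], so that their
   contributions add up when [c] is tilted along [w] or [- w]. *)
pose w := (t i * Num.sg (dot wi (e i))) *: wi + (t j * Num.sg (dot wj (e j))) *: wj.
have wi_sg : Num.sg (dot w (e i)) = t i.
  rewrite /w dotDl !dotZl (wji (e i)) // mulr0 addr0 -mulrA -normrEsg.
  by rewrite sgrM /t sgr_id (@gtr0_sg _ `|_|) ?mulr1 // normr_gt0.
have wj_sg : Num.sg (dot w (e j)) = t j.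
  rewrite /w dotDl !dotZl (wij (e j)) // mulr0 add0r -mulrA -normrEsg.
  by rewrite sgrM /t sgr_id (@gtr0_sg _ `|_|) ?mulr1 // normr_gt0.
have tilt s : s != 0 -> `|\sum_(l | O l) surplus (e l) * Num.sg (dot c (e l)) +
    Num.sg s * (`|surplus (e i)| + `|surplus (e j)|)| <= 1.
  move=> s0; have [eps _ epsP] := sg_perturb [seq e l | l <- enum I] c (s *: w).
  have {}epsP l := epsP _ (map_f e (mem_enum I l)).
  apply: le_trans z1; have := @deep_labeling_le _ e (c + eps *: (s *: w)) dp eP _.
  rewrite (bigD1 i) //= (bigD1 j) /=; last by rewrite eq_sym.
  rewrite !epsP ci cj eqxx !dotZl !sgrM wi_sg wj_sg /t.
  rewrite !(mulrCA _ (Num.sg s)) !sgD addrA -mulrDr addrC.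
  rewrite (eq_bigr (fun l => surplus (e l) * Num.sg (dot c (e l)))).
    apply=> l; rewrite -sgr_eq0 epsP; case: (eqVneq l i) => [->|li].
      by rewrite ci eqxx dotZl sgrM wi_sg mulf_neq0 ?sgr_eq0 //; case: (e0 i).
    case: (eqVneq l j) => [->|lj].
      by rewrite cj eqxx dotZl sgrM wj_sg mulf_neq0 ?sgr_eq0 //; case: (e0 j).
    by rewrite (negPf (cQ _ _)) ?sgr_eq0 ?cQ // /O li.
  by move=> l Ol; rewrite epsP (negPf (cQ _ Ol)).
(* The two absolute values sum to at least 2; no real lies in [-1, 1] both after adding and after
   subtracting such an amount. *)
have := tilt 1 (oner_neq0 _); have := tilt (-1) _; rewrite oppr_eq0 oner_eq0.
move=> /(_ isT); rewrite sgrN sgr1 mulN1r mul1r.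
have := surplus_norm_ge1 (proj2 (e0 i)); have := surplus_norm_ge1 (proj2 (e0 j)).
by rewrite !ler_norml => ? ? /andP[? ?] /andP[? ?]; lra.
Qed.

(** Cut by an affine hyperplane, lines through the origin become points and planes become lines, so
    [third_label_in_span] turns into the hypothesis of [sylvester_gallai]. *)
Lemma labels_coplanar (I : finType) (e : I -> 'rV[R]_d) i j :
    deep -> num_zero <= 1 -> labels_odd_lines e -> i != j ->
  forall l, (e l <= col_mx (e i) (e j))%MS.
Proof.
move=> dp z1 eP ij l; have [e0 eI _] := eP.
have [q|w we] := @generic_dot R d [seq e l | l <- enum I].
  by move=> /mapP[m _ ->]; case: (e0 m).
have {}we m : dot w (e m) != 0 by apply: we; rewrite map_f ?mem_enum.
(* the affine chart [dot w = 1] *)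
pose y m := (dot w (e m))^-1 *: e m.
have eE m : e m = dot w (e m) *: y m by rewrite scalerA divff // scale1r.
have wy m : dot w (y m) = 1 by rewrite dotZr mulVf.
have yI : injective y.
  by move=> m n mn; apply: eI; rewrite (eE m) mn scalerA scalemx_sub.
have spanP m a b : (e m <= col_mx (e a) (e b))%MS ->
    exists s t, y m = s *: y a + t *: y b.
  rewrite -addsmxE => /sub_addsmxP[[D1 D2] /= E].
  have [s Es] : exists s, D1 *m e a = s *: e a by apply/sub_rVP; rewrite submxMl.
  have [t Et] : exists t, D2 *m e b = t *: e b by apply/sub_rVP; rewrite submxMl.
  exists ((dot w (e m))^-1 * (s * dot w (e a))), ((dot w (e m))^-1 * (t * dot w (e b))).
  by rewrite -!scalerA -scalerDr -!eE -Es -Et -E.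
have [|s ys] := @sylvester_gallai _ _ _ y yI _ i j l ij.
  move=> a b ab; have [m [ma mb /spanP[s [t Em]]]] := third_label_in_span dp z1 eP ab.
  (* Applying [dot w] gives [s + t = 1]: the combination is affine. *)
  exists m; split=> //; exists t; have := wy m.
  rewrite Em dotDr (dotZr s) (dotZr t) !wy !mulr1 => /(canRL (addrK _)) ->.
  by apply/rowP => o; rewrite !mxE; ring.
rewrite (eE l) ys -addsmxE scalemx_sub //.
have yia : (y i <= e i + e j)%MS by rewrite scalemx_sub // addsmxSl.
have yja : (y j <= e i + e j)%MS by rewrite scalemx_sub // addsmxSr.
by rewrite addmx_sub // scalemx_sub // addmx_sub // -scaleN1r scalemx_sub.
Qed.

End Family.


(** * Alternating signs and sinusoids *)

Section SignSequences.
Context {R : realType}.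

(** Let [D i] be the sum with its first [i] terms negated. Since [D j - D j.+1] is [2 * s j] and
    both lie in [-1, 1], [D j = s j] and [D j.+1 = - s j]. Thus [D] alternates, and [D k = - D 0]
    makes [k] odd. *)
Lemma alternating_of_splits k (s : 'I_k -> R) : (0 < k)%N ->
    (forall j, s j = 1 \/ s j = -1) ->
    (forall i, (i <= k)%N -> `|\sum_(j < k) (-1) ^+ (j < i)%N * s j| <= 1) ->
  odd k /\ exists a : R, (a = 1 \/ a = -1) /\ forall j, s j = (-1) ^+ j * a.
Proof.
move=> k0 s1 sD; pose D i := \sum_(j < k) (-1) ^+ (j < i)%N * s j.
have DS (j : 'I_k) : D j - D j.+1 = s j *+ 2.
  rewrite /D -sumrB (bigD1 j) //= ltnn ltnSn big1 => [|i ij].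
    by rewrite addr0 expr0 expr1 mul1r mulN1r opprK.
  by move: ij; rewrite -val_eqE ltnS [(i <= j)%N]leq_eqVlt => /negPf->; rewrite subrr.
have Dj (j : 'I_k) : D j = s j /\ D j.+1 = - s j.
  have /ler_normlP[h1 h2] := sD j (ltnW (ltn_ord j)).
  have /ler_normlP[h3 h4] := sD _ (ltn_ord j).
  move: (DS j) h1 h2 h3 h4; rewrite -!/(D _) mulr2n.
  by case: (s1 j) => ->; split; lra.
have DE i : (i <= k)%N -> D i = (-1) ^+ i * D 0%N.
  elim: i => [|i IH] ik; first by rewrite mul1r.
  have [Di Di1] := Dj (Ordinal ik); rewrite /= in Di Di1.
  by rewrite Di1 -Di IH 1?ltnW // exprS mulN1r mulNr.
have a1 : D 0%N = 1 \/ D 0%N = -1.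
  by have [/= -> _] := Dj (Ordinal k0); apply: s1.
split; last by exists (D 0%N); split=> // j; rewrite -DE ?(ltnW (ltn_ord j)) //; case: (Dj j).
have : D k = - D 0%N.
  by rewrite /D -sumrN; apply: eq_bigr => j _; rewrite ltn_ord expr0 expr1 mul1r mulN1r.
rewrite DE // -signr_odd; case: (odd k) => //; rewrite mul1r.
by case: a1 => -> h; exfalso; lra.
Qed.

(** The classical estimate of an alternating series, adding two terms at a time. *)
Lemma alternating_sum_noninc n (s : nat -> R) :
    (forall i j, (i <= j <= n.*2)%N -> s j <= s i) ->
  s n.*2 <= \sum_(j < n.*2.+1) (-1) ^+ j * s j <= s 0%N.
Proof.
elim: n => [|n IH] H; first by rewrite big_ord1 /= expr0 mul1r lexx.
have /andP[IH1 IH2] := IH (fun i j ij => H i j ltac:(lia)).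
have e : (-1) ^+ n.*2 = 1 :> R by rewrite -signr_odd odd_double.
rewrite doubleS 2!big_ord_recr /= !exprS e mulr1 mulN1r mulrN mulr1 opprK mul1r.
have h1 := H n.*2 n.*2.+1 ltac:(lia); have h2 := H n.*2.+1 n.*2.+2 ltac:(lia).
by apply/andP; split; lra.
Qed.

Lemma alternating_sum_le1 k (s : nat -> R) : odd k ->
    (forall i, -1 <= s i <= 1) ->
    (forall i j, (i <= j < k)%N -> s j <= s i) \/
    (forall i j, (i <= j < k)%N -> s i <= s j) ->
  `|\sum_(j < k) (-1) ^+ j * s j| <= 1.
Proof.
move=> k_odd; have -> : k = k./2.*2.+1 by lia.
move: (k./2) => n {k k_odd} s1 [] H.
  have /andP[] := @alternating_sum_noninc n s (fun i j ij => H i j ltac:(lia)).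
  have := s1 0%N; have := s1 n.*2; rewrite ler_norml.
  by move=> /andP[? ?] /andP[? ?] ? ?; apply/andP; split; lra.
have Hn i j : (i <= j <= n.*2)%N -> - s j <= - s i.
  by move=> ij; rewrite lerN2; apply: H; lia.
have /andP[] := @alternating_sum_noninc n (fun j => - s j) Hn.
under eq_bigr do rewrite mulrN; rewrite sumrN.
have := s1 0%N; have := s1 n.*2; rewrite ler_norml.
by move=> /andP[? ?] /andP[? ?] ? ?; apply/andP; split; lra.
Qed.

(** Expansion about the phase [a]; the coefficients are the value and the derivative of the sinusoid
    at [a]. *)
Lemma sinusoid_shift (A B a t : R) : A * cos t + B * sin t =
  (A * cos a + B * sin a) * cos (t - a) +
  (- A * sin a + B * cos a) * sin (t - a).
Proof.
rewrite cosB sinB; have /(canRL (addrK _)) := cos2Dsin2 a.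
by move: (cos a) (sin a) (cos t) (sin t) => ? ? ? ? E; ring: E.
Qed.

(** Over less than a half turn a sinusoid changes sign at most once, so its signs at the increasing
    angles [al j] are monotone. *)
Lemma alternating_sum_sinusoid k (al : nat -> R) (A B : R)
    (f := fun t => A * cos t + B * sin t) : odd k ->
    (forall i j, (i < j < k)%N -> al i < al j) ->
    (forall j, (j < k)%N -> al j < al 0%N + pi) ->
  `|\sum_(j < k) (-1) ^+ j * Num.sg (f (al j))| <= 1.
Proof.
move=> k_odd al_lt al_pi; rewrite /f {f}.
have de j : (0 < j < k)%N -> 0 < al j - al 0%N < pi.
  by move=> jk; have := al_lt _ _ jk; have := al_pi j ltac:(lia) => ? ?;
    apply/andP; split; lra.
have sg1 (t : R) : -1 <= Num.sg t <= 1.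
  by case: sgrP; lra.
have noninc C D : 0 < C * cos (al 0%N) + D * sin (al 0%N) ->
    forall i j, (i <= j < k)%N ->
    Num.sg (C * cos (al j) + D * sin (al j)) <=
    Num.sg (C * cos (al i) + D * sin (al i)).
  move=> f0 i j ij; have [-> //|ji] := eqVneq j i.
  have [fi|fi] := ltP 0 (C * cos (al i) + D * sin (al i)).
    by rewrite (gtr0_sg fi); case/andP: (sg1 (C * cos (al j) + D * sin (al j))).
  have i0 : (0 < i)%N.
    by rewrite lt0n; apply: contraTneq f0 => i0; rewrite -i0 -leNgt.
  have si : 0 < sin (al i - al 0%N) by apply: sin_gt0_pi; rewrite de //; lia.
  have sj : 0 < sin (al j - al 0%N) by apply: sin_gt0_pi; rewrite de //; lia.
  have sij : 0 < sin (al j - al i).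
    apply: sin_gt0_pi; have := de i ltac:(lia); have := de j ltac:(lia).
    have := al_lt i j ltac:(lia).
    by move=> ? /andP[? ?] /andP[? ?]; apply/andP; split; lra.
  have E : al j - al i = (al j - al 0%N) - (al i - al 0%N) by ring.
  have fj : C * cos (al j) + D * sin (al j) < 0.
    move: f0 fi sij; rewrite E sinB (sinusoid_shift C D (al 0%N) (al i)).
    rewrite (sinusoid_shift C D (al 0%N) (al j)).
    move: (- C * _ + _) => g; move: (C * _ + _) => a0.
    move: (al i - _) (al j - _) si sj => ti tj.
    move: (sin ti) (sin tj) (cos ti) (cos tj) => Si Sj Ci Cj Si0 Sj0 a0_gt fi sij.
    (* With angles measured from [al 0], the value at [tj] times [sin ti] is the value at [ti] times
       [sin tj], minus the positive [a0 * sin (tj - ti)]. *)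
    rewrite -(pmulr_llt0 _ Si0).
    have -> : (a0 * Cj + g * Sj) * Si = (a0 * Ci + g * Si) * Sj - a0 * (Sj * Ci - Cj * Si) by ring.
    have := mulr_gt0 a0_gt sij; have := mulr_le0_ge0 fi (ltW Sj0); lra.
  by rewrite (ltr0_sg fj); case/andP: (sg1 (C * cos (al i) + D * sin (al i))).
apply: (@alternating_sum_le1 k
  (fun j => Num.sg (A * cos (al j) + B * sin (al j)))) => //.
have [f0|f0|f0] := ltrgt0P (A * cos (al 0%N) + B * sin (al 0%N)).
- by left; apply: noninc.
- right=> i j ij; rewrite -lerN2 -!sgrN !opprD -!mulNr; apply: noninc => //.
  by rewrite !mulNr -opprD oppr_gt0.
have fE j : (0 < j < k)%N -> Num.sg (A * cos (al j) + B * sin (al j)) =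
    Num.sg (- A * sin (al 0%N) + B * cos (al 0%N)).
  move=> jk; rewrite (sinusoid_shift A B (al 0%N)) f0 mul0r add0r sgrM.
  by rewrite (@gtr0_sg _ (sin _)) ?mulr1 // sin_gt0_pi // de.
have [g0|g0] := leP (- A * sin (al 0%N) + B * cos (al 0%N)) 0; [left|right];
  move=> [|i] [|j] ij //; rewrite ?(fE i.+1) ?(fE j.+1) //; try lia;
  by rewrite f0 sgr0 ?sgr_le0 ?sgr_ge0 // ltW.
Qed.

Lemma separating_value k (lo hi : 'I_k -> R) :
    (forall i j, lo i < hi j) -> exists t, forall i, lo i < t < hi i.
Proof.
case: k lo hi => [|k] lo hi H; first by exists 0 => -[].
case: (arg_maxP lo (erefl : xpredT (ord0 : 'I_k.+1))) => i _ maxi.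
case: (arg_minP hi (erefl : xpredT (ord0 : 'I_k.+1))) => j _ minj.
have maxi' l : lo l <= lo i := maxi l isT.
exists ((lo i + hi j) / 2) => l; have := H i j.
by have := maxi' l; have := minj l isT => ? ? ?; apply/andP; split; lra.
Qed.

(** The line at angle [phi] separates the first [i] angles from the others if
    [al j < phi < al j + pi] for [j < i] and [al j - pi < phi < al j] otherwise; [separating_value]
    meets these conditions together. *)
Lemma splitting_angle k (al : 'I_k -> R) (i : nat) :
    (forall j l : 'I_k, (j < l)%N -> al j < al l) ->
    (forall j l, al j < al l + pi) ->
  exists phi, forall j, Num.sg (sin (al j - phi)) = (-1) ^+ (j < i)%N.
Proof.
move=> al_lt al_pi; have pi0 : 0 < pi :> R := pi_gt0 R.
have [j l|phi H] := @separating_value k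
    (fun j => if (j < i)%N then al j else al j - pi)
    (fun j => if (j < i)%N then al j + pi else al j).
  have := al_pi j l; case: (ltnP j i) => ji; case: (ltnP l i) => li.
  - by [].
  - by move=> _; apply: al_lt; lia.
  - lra.
  - lra.
exists phi => j; have := H j; case: ifP => _ /andP[h1 h2].
  rewrite expr1 ltr0_sg // -oppr_gt0 -sinN sin_gt0_pi //.
  by apply/andP; split; lra.
by rewrite expr0 gtr0_sg // sin_gt0_pi //; apply/andP; split; lra.
Qed.

(** The sine of [t' - t] vanishes, which inside an open full turn happens only at [pi]. *)
Lemma opposite_angles (t t' s : R) : 0 < s -> t < t' < t + 2 * pi ->
  cos t' = - s * cos t -> sin t' = - s * sin t -> t' = t + pi.
Proof.
move=> s0 /andP[t1 t2] Ec Es; have : sin (t' - t) = 0 by rewrite sinB Ec Es; ring.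
have [h|h|h] := ltrgtP (t' - t) pi; last by move=> _; lra.
  by have : 0 < sin (t' - t) by [apply: sin_gt0_pi; apply/andP; split; lra|]; lra.
have : 0 < sin (t' - t - pi) by apply: sin_gt0_pi; apply/andP; split; lra.
by rewrite sinB cospi sinpi; lra.
Qed.

End SignSequences.


(** * Halving splits, perfect hyperplanes and depth *)

Section Halving.
Context {R : realType} {T : finType}.

(** Let [lam] be the largest value of [f] that at least [m] points reach; fewer than [m] exceed it.
    Either fewer than [m] are below it too, or exactly [m] points reach [lam] and they form [A]. *)
Lemma median_split (f : T -> R) m : #|T| = m.*2 -> (0 < m)%N ->
  (exists lam, (#|[pred y | (lam < f y)%R]| < m)%N /\ (#|[pred y | (f y < lam)%R]| < m)%N)
  \/ exists2 A : {set T}, #|A| = m & forall t b, t \in A -> b \notin A -> f b < f t.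
Proof.
move=> Tm m0; pose P y := (m <= #|[pred z | (f y <= f z)%R]|)%N.
have /card_gt0P[y00 _] : (0 < #|T|)%N by rewrite Tm double_gt0.
have [y0 Py0] : exists y, P y.
  case: (arg_minP f (erefl : xpredT y00)) => y _ miny; exists y.
  rewrite /P (eq_card (B := T)) ?Tm; first lia.
  by move=> z; rewrite !inE; apply: miny.
case: (arg_maxP f Py0) => y Py maxy; set lam := f y.
have top : (#|[pred z | (lam < f z)%R]| < m)%N.
  rewrite ltnNge; apply/negP => mtop.
  have /card_gt0P[z0 z0_top] : (0 < #|[pred z | (lam < f z)%R]|)%N by lia.
  case: (arg_minP f z0_top) => z z_top minz.
  have : P z.
    apply: leq_trans mtop _; apply: subset_leq_card; apply/fintype.subsetP => t.
    by rewrite !inE => ht; apply: minz.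
  by move=> /maxy /(lt_le_trans z_top); rewrite ltxx.
have [bot|bot] := ltnP #|[pred z | (f z < lam)%R]| m; first by left; exists lam.
right; exists [set z | lam <= f z] => [|t b]; last first.
  by rewrite !inE -ltNge => h1 h2; apply: lt_le_trans h1.
have E : #|[set z | lam <= f z]| = #|[pred z | lam <= f z]|.
  by apply: eq_card => z; rewrite !inE.
have EC : #|[predC [pred z | (lam <= f z)%R]]| = #|[pred z | (f z < lam)%R]|.
  by apply: eq_card => z; rewrite !inE ltNge.
have C : (#|[pred z | (lam <= f z)%R]| + #|[pred z | (f z < lam)%R]| = m.*2)%N.
  by rewrite -Tm -EC; apply: cardC.
have : (m <= #|[pred z | (lam <= f z)%R]|)%N := Py.
by rewrite E; move: bot; lia.
Qed.

End Halving.

Section Perfect.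
Context {R : realType} {d : nat} {T : finType}.
Variable p : T -> 'rV[R]_d.

Lemma imbalance_count c : imbalance p c =
  #|[pred y | 0 < dot c (p y)]|%:R - #|[pred y | dot c (p y) < 0]|%:R.
Proof.
rewrite -!sum1_card !natr_sum [X in X - _]big_mkcond [X in _ - X]big_mkcond.
rewrite -sumrB; apply: eq_bigr => y _; rewrite !inE.
case: ltrgt0P => [c0|c0|->]; last by rewrite sgr0 subrr.
  by rewrite gtr0_sg // subr0.
by rewrite ltr0_sg // sub0r.
Qed.

Lemma num_orthogonal_count c :
  num_orthogonal p c = #|[pred y | dot c (p y) == 0]|%:R.
Proof.
rewrite -sum1_card natr_sum [RHS]big_mkcond; apply: eq_bigr => y _.
by rewrite inE; case: eqP.
Qed.

Lemma card_sides (f : T -> R) : (#|[pred y | (0 < f y)%R]| +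
  #|[pred y | (f y < 0)%R]| + #|[pred y | (f y == 0)%R]| = #|T|)%N.
Proof.
rewrite -!sum1_card (big_mkcond [pred y | (0 < f y)%R]).
rewrite (big_mkcond [pred y | (f y < 0)%R]) (big_mkcond [pred y | (f y == 0)%R]).
by rewrite -!big_split; apply: eq_bigr => y _; rewrite !inE /=; case: ltrgt0P.
Qed.

Lemma deepP : deep p <->
  forall c, (2 * #|[pred y | (0 < dot c (p y))%R]| <= #|T|)%N.
Proof.
split=> H c; have := H c; rewrite imbalance_count num_orthogonal_count;
  rewrite lerBlDr -natrD ler_nat -(card_sides (fun y => dot c (p y))); lia.
Qed.

(** With the origin placed at [x], a hyperplane contains [x] exactly when its offset is 0. *)
Definition perfect_offsets_zero : Prop := forall c (lam : R), c != 0 ->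
  (2 * #|[pred y | (lam < dot c (p y))%R]| < #|T|)%N ->
  (2 * #|[pred y | (dot c (p y) < lam)%R]| < #|T|)%N -> lam = 0.

(** A perfect hyperplane with [lam > 0] would leave more than half of the vectors at [dot c >= lam],
    inside an open halfspace that holds at most half. Negating [c] settles [lam < 0]. *)
Lemma deep_perfect : deep p -> perfect_offsets_zero.
Proof.
move=> /deepP dp.
have half c lam : (0 < lam)%R ->
    (2 * #|[pred y | (dot c (p y) < lam)%R]| < #|T|)%N -> False.
  move=> lam0.
  have C : (#|[pred y | (dot c (p y) < lam)%R]| +
      #|[predC [pred y | (dot c (p y) < lam)%R]]| = #|T|)%N by apply: cardC.
  have := dp c; have : (#|[predC [pred y | (dot c (p y) < lam)%R]]| <=
      #|[pred y | (0 < dot c (p y))%R]|)%N.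
    apply: subset_leq_card; apply/fintype.subsetP => y; rewrite !inE -leNgt.
    exact: lt_le_trans.
  by lia.
move=> c lam c0 pos neg; have [lam0|lam0|//] := ltrgt0P lam.
  by case: (half c lam).
case: (half (- c) (- lam)); first by rewrite oppr_gt0.
rewrite (eq_card (B := [pred y | (lam < dot c (p y))%R])) // => y.
by rewrite !inE dotNl ltrN2.
Qed.

(** As [k] decreases from large values, [u + k *: c] keeps [A] above its complement until a vector
    of [A] becomes level with one outside. The hyperplane at that level has fewer than [m] vectors
    on each side, so it is perfect and passes through the origin. *)
Lemma pivot (A : {set T}) (c u : 'rV[R]_d) m :
    #|T| = m.*2 -> #|A| = m -> (0 < m)%N -> perfect_offsets_zero ->
    (forall t b, t \in A -> b \notin A -> dot c (p b) < dot c (p t)) ->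
    (forall k, u + k *: c != 0) ->
  exists2 k, (forall t, t \in A -> 0 <= dot (u + k *: c) (p t)) &
             (forall b, b \notin A -> dot (u + k *: c) (p b) <= 0).
Proof.
move=> Tm Am m0 pz sepA uc0.
have /card_gt0P[t0 t0A] : (0 < #|A|)%N by rewrite Am.
have CA : #|~: A| = m by rewrite cardsCs finset.setCK Am Tm; lia.
have /card_gt0P[b0 b0A] : (0 < #|~: A|)%N by rewrite CA.
rewrite inE in b0A.
(* The value of [k] at which the two vectors are level; the largest one is the first contact. *)
pose r (i : T * T) := - (dot u (p i.1) - dot u (p i.2)) /
  (dot c (p i.1) - dot c (p i.2)).
pose Q (i : T * T) := (i.1 \in A) && (i.2 \notin A).
have Q0 : Q (t0, b0) by apply/andP.
case: (arg_maxP r Q0) => -[t1 b1] /andP[/= t1A b1A] maxr; pose k := r (t1, b1).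
have eqk : dot (u + k *: c) (p t1) = dot (u + k *: c) (p b1).
  have := sepA _ _ t1A b1A; rewrite -subr_gt0 => /lt0r_neq0 c0.
  by rewrite !dotDl !dotZl /k /r /=; field.
have lek t b : t \in A -> b \notin A ->
    dot (u + k *: c) (p b) <= dot (u + k *: c) (p t).
  move=> tA bA; have : r (t, b) <= k by apply: maxr; rewrite /Q tA.
  have := sepA _ _ tA bA; rewrite -subr_gt0 => c0.
  by rewrite /r ler_pdivrMr //= !dotDl !dotZl; lra.
have zero : dot (u + k *: c) (p t1) = 0.
  apply: (pz (u + k *: c)) => //; rewrite Tm.
    have : (#|[pred y | (dot (u + k *: c) (p t1) < dot (u + k *: c) (p y))%R]|
        <= #|A :\ t1|)%N.
      apply: subset_leq_card; apply/fintype.subsetP => y; rewrite !inE => h.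
      apply/andP; split; first by apply: contraTneq h => ->; rewrite ltxx.
      by apply: contraTT h => yA; rewrite -leNgt; apply: lek.
    rewrite mul2n ltn_double => /leq_ltn_trans; apply.
    by have := cardsD1 t1 A; rewrite t1A Am; lia.
  have : (#|[pred y | (dot (u + k *: c) (p y) < dot (u + k *: c) (p t1))%R]|
      <= #|(~: A) :\ b1|)%N.
    apply: subset_leq_card; apply/fintype.subsetP => y; rewrite !inE eqk => h.
    apply/andP; split; first by apply: contraTneq h => ->; rewrite ltxx.
    by apply: contraTN h => yA; rewrite -leNgt; apply: lek.
  rewrite mul2n ltn_double => /leq_ltn_trans; apply.
  by rewrite -CA (cardsD1 b1 (~: A)) inE b1A add1n ltnS.
exists k => [t tA|b bA].
  by rewrite -zero eqk lek.
by rewrite -zero lek.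
Qed.

Lemma perfect_deep : ~~ odd #|T| ->
    (forall q v, v != 0 -> exists y, ~ exists t : R, p y = q + t *: v) ->
  perfect_offsets_zero -> deep p.
Proof.
move=> T_even noncol pz; apply/deepP => c; rewrite leqNgt; apply/negP => c_large.
pose m := #|T|./2; have Tm : #|T| = m.*2 by rewrite /m; lia.
have m0 : (0 < m)%N.
  have : (#|T| < 2 * #|T|)%N.
    by apply: leq_trans c_large _; rewrite leq_mul2l max_card.
  by rewrite Tm; lia.
have c0 : c != 0.
  apply: contraTneq c_large => ->; rewrite -leqNgt [X in (2 * X)%N]eq_card0 ?muln0 //.
  by move=> y; rewrite !inE dot0l ltxx.
have [[lam [top bot]]|[A Am sepA]] := median_split (fun y => dot c (p y)) Tm m0.
  have E : lam = 0 by apply: (pz c) => //; rewrite Tm mul2n ltn_double.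
  by move: top c_large; rewrite E Tm mul2n ltn_double => top /(ltn_trans top); rewrite ltnn.
have /card_gt0P[t0 t0A] : (0 < #|A|)%N by rewrite Am.
have [b0 b0A b0_gt0] : exists2 b, b \notin A & 0 < dot c (p b).
  apply: contrapT => nob; have : (#|[pred y | (0 < dot c (p y))%R]| <= #|A|)%N.
    apply: subset_leq_card; apply/fintype.subsetP => y; rewrite inE => y_gt0.
    by apply: contrapT => /negP yA; apply: nob; exists y.
  by rewrite Am leqNgt -ltn_double -Tm -mul2n c_large.
pose v := p t0 - p b0.
have cv : 0 < dot c v by rewrite dotBr subr_gt0 sepA.
have v0 : v != 0 by apply: contraTneq cv => ->; rewrite dot0r ltxx.
have [y3 y3_off] := noncol (p b0) v v0.
(* As [u] is orthogonal to [c] and in the span of [v] and [p y3 - p b0], no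
   [u + k *: c] can be orthogonal to both [v] and [p y3 - p b0]. *)
pose u := dot c v *: (p y3 - p b0) - dot c (p y3 - p b0) *: v.
have cu : dot c u = 0 by rewrite dotBr !dotZr; ring.
have u0 : u != 0.
  apply/eqP => /eqP; rewrite subr_eq0 => /eqP E; apply: y3_off.
  exists ((dot c v)^-1 * dot c (p y3 - p b0)).
  by rewrite -scalerA -E scalerA mulVf ?lt0r_neq0 // scale1r addrC subrK.
have uu : 0 < dot u u by rewrite dot_gt0.
have uc0 k : u + k *: c != 0.
  apply: contraTneq uu => E; suff -> : dot u u = 0 by rewrite ltxx.
  have : dot (u + k *: c) u = 0 by rewrite E dot0l.
  by rewrite dotDl dotZl cu mulr0 addr0.
have nuc0 k : - u + k *: c != 0.
  by rewrite -oppr_eq0 opprD opprK -scaleNr.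
have [k kA kB] := pivot Tm Am m0 pz sepA uc0.
have [l lA lB] := pivot Tm Am m0 pz sepA nuc0.
have kE z w : dot (z + k *: c) w + dot (- z + l *: c) w = (k + l) * dot c w.
  by rewrite !dotDl !dotZl dotNl; ring.
(* The two directions add up to [(k + l) *: c], nonpositive at [b0] and nonnegative at [t0], while
   [c] is positive at both. *)
have kl : k + l = 0.
  apply/eqP; rewrite eq_le; apply/andP; split.
    rewrite -(pmulr_lle0 _ b0_gt0) -(kE u).
    by have := kB _ b0A; have := lB _ b0A; lra.
  have t0_gt0 : 0 < dot c (p t0) by apply: lt_trans b0_gt0 _; apply: sepA.
  rewrite -(pmulr_lge0 _ t0_gt0) -(kE u).
  by have := kA _ t0A; have := lA _ t0A; lra.
have all0 y : dot (u + k *: c) (p y) = 0.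
  have := kE u (p y); rewrite kl mul0r; have [yA|yA] := boolP (y \in A).
    by have := kA _ yA; have := lA _ yA; lra.
  by have := kB _ yA; have := lB _ yA; lra.
have u_span q : dot q v = 0 -> dot q (p y3 - p b0) = 0 -> dot q u = 0.
  by move=> qv qy; rewrite /u (dotBr _ _ q) !(dotZr _ _ q) qv qy !mulr0 subr0.
have : dot (u + k *: c) u = 0 by apply: u_span; rewrite dotBr !all0 subrr.
by rewrite dotDl dotZl cu mulr0 addr0 => E; rewrite E ltxx in uu.
Qed.

End Perfect.


(** * Votes, lines and labels in terms of the vectors from [x] to the points of [S] *)

Section Game.
Context {R : realType} {d : nat}.
Variable S : {fset 'rV[R]_d}.
Implicit Types (x a b c u v w : 'rV[R]_d).

Definition offset x (y : S) : 'rV[R]_d := fsval y - x.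

Lemma nptsE (A : set 'rV[R]_d) (P : pred S) :
  (forall y : S, A (fsval y) <-> P y) -> npts S A = #|P|.
Proof.
move=> AP; rewrite /npts card_fset_sum1 big_fset /= big_seq_fsetE /=.
rewrite sum1_card; apply: eq_card => y; rewrite !unfold_in.
by apply/idP/idP => [/asboolP/AP|/AP/asboolP].
Qed.

Lemma dist_lt a b (y : 'rV[R]_d) : (dist a y < dist b y) =
  (dot (a - y) (a - y) < dot (b - y) (b - y)).
Proof. by rewrite !ltNge /dist ler_psqrt // nnegrE dot_ge0. Qed.

Lemma closer a w (y : 'rV[R]_d) :
  (dist (a + w) y < dist a y) = (dot w w < 2 * dot w (y - a)).
Proof.
rewrite dist_lt -subr_gt0 -[RHS]subr_gt0; congr (0 < _).
by rewrite !dot_lin (dotC y a) (dotC w a) (dotC w y); ring.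
Qed.

Lemma farther a w (y : 'rV[R]_d) :
  (dist a y < dist (a + w) y) = (2 * dot w (y - a) < dot w w).
Proof.
rewrite dist_lt -subr_gt0 -[RHS]subr_gt0; congr (0 < _).
by rewrite !dot_lin (dotC y a) (dotC w a) (dotC w y); ring.
Qed.

Lemma positive_bound (T : finType) (f : T -> R) :
  exists2 eps, 0 < eps & forall t, 0 < f t -> eps < f t.
Proof.
have [[y0 y0P]|noy] := pselect (exists t, 0 < f t); last first.
  by exists 1 => // y fy; case: noy; exists y.
case: (@arg_minP _ _ _ y0 (fun t => 0 < f t) f y0P) => y fy miny.
exists (f y / 2) => [|z /miny]; first by rewrite divr_gt0.
by move=> fz; have : 0 < f y := fy; lra.
Qed.

(** If Bob plays [x + w], his voters lie in the open halfspace [dot w > 0] based at [x], and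
    everyone outside it votes for Alice. Conversely, with [w] a small positive multiple of [c], he
    gets the whole open halfspace of [c]. *)
Lemma winning_deep x : winning S x <-> deep (offset x).
Proof.
rewrite deepP; split=> H c.
  have [->|c0] := eqVneq c 0.
    by rewrite [X in (2 * X)%N]eq_card0 ?muln0 // => y; rewrite !inE dot0l ltxx.
  have [del del0 delP] := positive_bound (fun y => dot c (offset x y)).
  have cc : 0 < dot c c by rewrite dot_gt0.
  pose eps := del / dot c c; have eps0 : 0 < eps by rewrite divr_gt0.
  have := H (x + eps *: c); rewrite /votes_A /votes_B.
  rewrite (@nptsE _ [pred y : S | dot (eps *: c) (eps *: c) <
      2 * dot (eps *: c) (offset x y)]); last first.
    by move=> y /=; rewrite closer.
  rewrite (@nptsE _ [pred y : S | 2 * dot (eps *: c) (offset x y) <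
      dot (eps *: c) (eps *: c)]); last first.
    by move=> y /=; rewrite farther.
  have epsE : dot (eps *: c) (eps *: c) = eps * del.
    by rewrite dotZl dotZr /eps divfK // lt0r_neq0.
  rewrite epsE => BA.
  have h1 : (#|[pred y | (0 < dot c (offset x y))%R]| <=
      #|[pred y : S | (eps * del < 2 * dot (eps *: c) (offset x y))%R]|)%N.
    apply: subset_leq_card; apply/fintype.subsetP => y; rewrite !inE => /delP h.
    by rewrite dotZl mulrCA ltr_pM2l //; lra.
  have C : (#|[pred y | (0 < dot c (offset x y))%R]| +
      #|[predC [pred y | (0 < dot c (offset x y))%R]]| = #|{: S}|)%N by apply: cardC.
  have h2 : (#|[pred y : S | (2 * dot (eps *: c) (offset x y) < eps * del)%R]| <=
      #|[predC [pred y | (0 < dot c (offset x y))%R]]|)%N.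
    apply: subset_leq_card; apply/fintype.subsetP => y; rewrite !inE.
    by apply: contraTN => /delP h; rewrite -leNgt dotZl mulrCA ler_pM2l //; lra.
  by rewrite -C mul2n -addnn leq_add2l; apply: leq_trans h1 (leq_trans BA h2).
have -> : c = x + (c - x) by rewrite addrC subrK.
move: (c - x) => {c} w; have [->|w0] := eqVneq w 0.
  by rewrite addr0.
have ww : 0 < dot w w by rewrite dot_gt0.
rewrite /votes_A /votes_B.
rewrite (@nptsE _ [pred y : S | dot w w < 2 * dot w (offset x y)]); last first.
  by move=> y /=; rewrite closer.
rewrite (@nptsE _ [pred y : S | 2 * dot w (offset x y) < dot w w]); last first.
  by move=> y /=; rewrite farther.
have C : (#|[pred y | (0 < dot w (offset x y))%R]| +
    #|[predC [pred y | (0 < dot w (offset x y))%R]]| = #|{: S}|)%N by apply: cardC.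
apply: (@leq_trans #|[pred y | (0 < dot w (offset x y))%R]|).
  apply: subset_leq_card; apply/fintype.subsetP => y; rewrite !inE; lra.
apply: (@leq_trans #|[predC [pred y | (0 < dot w (offset x y))%R]]|).
  by have := H w; rewrite -C mul2n -addnn leq_add2l.
apply: subset_leq_card; apply/fintype.subsetP => y; rewrite !inE -leNgt; lra.
Qed.

Lemma perfect_offsets x :
  perfect_hyperplanes_contain S x <-> perfect_offsets_zero (offset x).
Proof.
have posE c lam : npts S (hyperplane_pos c lam) =
    #|[pred y | (lam - dot c x < dot c (offset x y))%R]|.
  by apply: nptsE => y; rewrite /hyperplane_pos /= dotBr ltrD2r dotC.
have negE c lam : npts S (hyperplane_neg c lam) =
    #|[pred y | (dot c (offset x y) < lam - dot c x)%R]|.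
  by apply: nptsE => y; rewrite /hyperplane_neg /= dotBr ltrD2r dotC.
split=> H c lam c0; [move=> pos neg|move=> [pos neg]].
  have : hyperplane c (lam + dot c x) x.
    by apply: H => //; split; rewrite ?posE ?negE addrK cardfE.
  by rewrite /hyperplane /= dotC => E; apply: (addIr (dot c x)); rewrite -E add0r.
have := H c (lam - dot c x) c0; rewrite -posE -negE -cardfE => /(_ pos neg).
by move=> /eqP; rewrite subr_eq0 /hyperplane /= dotC => /eqP.
Qed.

Lemma lineP x v y : line x v y <-> (y - x <= v)%MS.
Proof.
split=> [[t _ <-]|/sub_rVP[t E]]; first by rewrite addrC addKr scalemx_sub.
by exists t => //; rewrite -E addrC subrK.
Qed.

Lemma halflineP x v y : v != 0 ->
  halfline x v y <-> (y - x <= v)%MS && (0 < dot v (y - x)).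
Proof.
rewrite -dot_gt0 => v0; split=> [[t /= t0 <-]|/andP[/sub_rVP[t E]]].
  by rewrite addrC addKr scalemx_sub //= dotZr mulr_gt0.
rewrite E dotZr pmulr_lgt0 // => t0; exists t => //=.
by rewrite -E addrC subrK.
Qed.

Lemma halfline_count x v : v != 0 ->
  npts S (halfline x v) =
  #|[pred y | (offset x y <= v)%MS && (0 < dot v (offset x y))%R]|.
Proof. by move=> v0; apply: nptsE => y; apply: halflineP. Qed.

Lemma halfline_opp_count x v : v != 0 ->
  npts S (halfline x (- v)) =
  #|[pred y | (offset x y <= v)%MS && (dot v (offset x y) < 0)%R]|.
Proof.
move=> v0; apply: nptsE => y; rewrite halflineP ?oppr_eq0 // inE.
by rewrite (eqmx_opp v) dotNl oppr_gt0.
Qed.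

Lemma surplus_npts x v : v != 0 -> surplus (offset x) v =
  (npts S (halfline x v))%:R - (npts S (halfline x (- v)))%:R.
Proof. by move=> v0; rewrite surplus_count halfline_count // halfline_opp_count. Qed.

Lemma balancedP x v : v != 0 ->
  balanced S x v <-> `|surplus (offset x) v| <= 1.
Proof.
move=> v0; rewrite /balanced surplus_npts //.
move: (npts S (halfline x v)) (npts S (halfline x (- v))) => m n.
have -> : m%:R - n%:R = (m%:Z - n%:Z)%:~R :> R by rewrite intrB.
by rewrite -intr_norm lerz1.
Qed.

Lemma balanced_values x v : v != 0 -> balanced S x v ->
  [\/ surplus (offset x) v = 0, surplus (offset x) v = 1 |
      surplus (offset x) v = -1].
Proof.
move=> v0 /(balancedP _ v0).
have [->|s0] := eqVneq (surplus (offset x) v) 0; first by constructor.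
move=> le1; have ge1 := surplus_norm_ge1 s0.
have /eqP : `|surplus (offset x) v| = 1 by apply/eqP; rewrite eq_le le1.
by rewrite eqr_norml ler01 andbT => /orP[]/eqP; [constructor 2|constructor 3].
Qed.

Lemma line_count x v : v != 0 -> npts S (line x v `\ x)%classic =
  (npts S (halfline x v) + npts S (halfline x (- v)))%N.
Proof.
move=> v0; rewrite halfline_count // halfline_opp_count //.
rewrite (@nptsE _ [pred y | (offset x y <= v)%MS && (offset x y != 0)]); last first.
  move=> y; split=> [[/lineP yv /eqP yx]|/andP[yv yx]].
    by rewrite /= yv subr_eq0.
  by split; [apply/lineP | move/eqP; rewrite -subr_eq0 (negPf yx)].
rewrite -!sum1_card (big_mkcond [pred y | (offset x y <= v)%MS && (offset x y != 0)]).
rewrite (big_mkcond [pred y | (offset x y <= v)%MS && (0 < dot v (offset x y))%R]).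
rewrite (big_mkcond [pred y | (offset x y <= v)%MS && (dot v (offset x y) < 0)%R]).
rewrite -big_split; apply: eq_bigr => y _; rewrite !inE /=.
case: (boolP (_ <= v)%MS) => //= yv.
have [->|y0] := eqVneq (offset x y) 0; first by rewrite dot0r ltxx.
by have := dot_line_neq0 y0 yv; case: ltrgt0P.
Qed.

(** The two sides of a balanced line differ by at most one point, so their total is odd exactly when
    they differ. *)
Lemma odd_balancedP x v : v != 0 ->
  odd_balanced S x v <-> balanced S x v /\ surplus (offset x) v != 0.
Proof.
move=> v0; rewrite /odd_balanced line_count // surplus_npts // subr_eq0 eqr_nat.
by rewrite /balanced; split=> -[H1 H2]; split=> //; move: H1 H2; lia.
Qed.

Lemma num_zeroE x : num_zero (offset x) = (x \in S)%:R.
Proof.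
have [xS|xS] := boolP (x \in S).
  rewrite /num_zero (bigD1 [` xS]%fset) //= /offset subrr eqxx big1 ?addr0 // => y yx.
  by rewrite subr_eq0 (negPf (_ : fsval y != x)) // -[x]/(fsval [` xS]%fset) val_eqE.
rewrite /num_zero big1 // => y _; rewrite /offset subr_eq0.
by rewrite (negPf (_ : fsval y != x)) //; apply: contraNneq xS => <-; apply: fsvalP.
Qed.

Lemma num_zero_le1 x : num_zero (offset x) <= 1.
Proof. by rewrite num_zeroE; case: (x \in S). Qed.

Lemma line_eq x u v : (u <= v)%MS -> (v <= u)%MS -> line x u = line x v.
Proof.
move=> uv vu; apply/seteqP; split=> y /lineP h; apply/lineP;
  exact: submx_trans h _.
Qed.

Lemma line_sub x u v : line x u = line x v -> (u <= v)%MS.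
Proof.
move=> E; have : line x v (x + u) by rewrite -E; apply/lineP; rewrite addrC addKr.
by move=> /lineP; rewrite addrC addKr.
Qed.

Lemma labelingP x k (e : 'I_k -> 'rV[R]_d) :
    (forall v, v != 0 -> balanced S x v) ->
  odd_balanced_labeling S x e <-> labels_odd_lines (offset x) e.
Proof.
move=> bal; split=> -[e0 eI eS]; split.
- by move=> i; have [ei0 /(odd_balancedP _ ei0)[]] := e0 i.
- move=> i j ij; apply: eI; apply: line_eq => //.
  by apply: line_sym ij; case: (e0 i).
- move=> v v0 sv; have [|i /line_sub vi] := eS v v0; last by exists i.
  by apply/odd_balancedP => //; split=> //; apply: bal.
- move=> i; have [ei0 si] := e0 i; split=> //.
  by apply/odd_balancedP => //; split=> //; apply: bal.
- by move=> i j /line_sub; apply: eI.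
- move=> v v0 /(odd_balancedP _ v0)[_ /(eS _ v0)[i vi]]; exists i.
  by apply: line_eq vi (line_sym v0 vi).
Qed.

End Game.

(** * Planes and orthonormal frames *)

Section Planes.
Context {R : realType} {d : nat}.
Implicit Types (x p u v w : 'rV[R]_d).

Lemma row_free_col u v : u != 0 -> ~~ (v <= u)%MS -> row_free (col_mx u v).
Proof.
move=> u0 vu; apply: inj_row_free => w; rewrite -[w]hsubmxK mul_row_col.
rewrite (mx11_scalar (lsubmx w)) (mx11_scalar (rsubmx w)) !mul_scalar_mx.
move: (lsubmx w 0 0) (rsubmx w 0 0) => s t E.
have t0 : t = 0.
  apply: contraNeq vu => t0; apply/sub_rVP; exists (- t^-1 * s).
  rewrite mulNr scaleNr -scalerA -scalerN (_ : - (s *: u) = t *: v).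
    by rewrite scalerA mulVf // scale1r.
  by apply/eqP; rewrite eq_sym -subr_eq0 opprK addrC E.
move: E; rewrite t0 scale0r addr0 => /eqP; rewrite scaler_eq0 (negPf u0) orbF.
by move=> /eqP ->; rewrite !raddf0 row_mx0.
Qed.

(** Supplies the plane when there is at most one odd-balanced line; in dimension at least 2 some
    vector lies off any given line. *)
Lemma exists_plane_through (w : 'rV[R]_d) : (2 <= d)%N ->
  exists u v : 'rV[R]_d, row_free (col_mx u v) /\ (w <= col_mx u v)%MS.
Proof.
move=> d2; have off u : exists v : 'rV[R]_d, ~~ (v <= u)%MS.
  apply: contrapT => H; have : ((1%:M : 'M[R]_d) <= u)%MS.
    by apply/row_subP => i; apply/negPn/negP => h; apply: H; exists (row i 1%:M).
  by move=> /mxrankS; rewrite mxrank1 => /leq_trans/(_ (rank_leq_row _)); lia.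
have [u [u0 wu]] : exists u : 'rV[R]_d, u != 0 /\ (w <= u)%MS.
  have [->|w0] := eqVneq w 0; last by exists w.
  have [u u0] := off 0; exists u; split; last exact: sub0mx.
  by apply: contraNneq u0 => ->; apply: sub0mx.
have [v vu] := off u; exists u, v; split; first exact: row_free_col.
by rewrite (submx_trans wu) // -addsmxE addsmxSl.
Qed.

Lemma planeP x u v y : plane x u v y <-> (y - x <= col_mx u v)%MS.
Proof.
rewrite -addsmxE; split=> [[s [t ->]]|/sub_addsmxP[[D1 D2] /= E]].
  by rewrite -[X in X - _]addrA (addrC x) addrK addmx_sub // scalemx_sub // ?addsmxSl ?addsmxSr.
have [s Es] : exists s, D1 *m u = s *: u by apply/sub_rVP; rewrite submxMl.
have [t Et] : exists t, D2 *m v = t *: v by apply/sub_rVP; rewrite submxMl.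
by exists s, t; rewrite -addrA -Es -Et -E addrC subrK.
Qed.

Lemma plane_frame (P : set 'rV[R]_d) x : is_plane P -> P x ->
  exists u v, orthonormal2 u v /\ P = plane x u v.
Proof.
move=> [q [u [v [uv PE]]]]; rewrite PE => /planeP xq.
have u0 : u != 0.
  apply: contraTneq uv => ->; rewrite -row_leq_rank -ltnNge -addsmxE.
  by rewrite adds0mx ltnS rank_leq_row.
have vu : ~~ (v <= u)%MS.
  apply: contraTN uv => vu; rewrite -row_leq_rank -ltnNge -addsmxE.
  by rewrite (addsmx_idPl vu) ltnS rank_leq_row.
have [z0 _] := dot_proj v u0; set z := v - _ in z0.
have zN0 : z != 0.
  by apply: contraNneq vu => /eqP; rewrite subr_eq0 => /eqP->; rewrite scalemx_sub.
have norm1 w : w != 0 -> dot ((Num.sqrt (dot w w))^-1 *: w)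
    ((Num.sqrt (dot w w))^-1 *: w) = 1.
  rewrite -dot_gt0 => w0; rewrite dotZl dotZr mulrA -invfM -expr2.
  by rewrite sqr_sqrtr ?ltW // mulVf ?lt0r_neq0.
exists ((Num.sqrt (dot u u))^-1 *: u), ((Num.sqrt (dot z z))^-1 *: z); split.
  by split; [exact: norm1 | exact: norm1 | rewrite dotZl dotZr (dotC u) z0 !mulr0].
have sE : (col_mx u v :=: col_mx ((Num.sqrt (dot u u))^-1 *: u)
    ((Num.sqrt (dot z z))^-1 *: z))%MS.
  apply: eqmx_trans (eqmx_sym (addsmxE _ _)) _.
  apply: eqmx_trans _ (addsmxE _ _).
  have un w : w != 0 -> ((Num.sqrt (dot w w))^-1 *: w :=: w)%MS.
    by rewrite -dot_gt0 => w0; apply: eqmx_scale; rewrite invr_eq0 sqrtr_eq0 -ltNge.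
  apply: eqmx_trans _ (eqmx_sym (adds_eqmx (un _ u0) (un _ zN0))).
  apply/eqmxP/andP; split; rewrite addsmx_sub addsmxSl /=.
    have -> : v = z + (dot v u / dot u u) *: u by rewrite subrK.
    by rewrite addmx_sub ?addsmxSr // scalemx_sub // addsmxSl.
  by rewrite addmx_sub ?addsmxSr // -scaleNr scalemx_sub // addsmxSl.
apply/seteqP; split=> y /planeP h; apply/planeP.
  have -> : y - x = (y - q) - (x - q) by apply/rowP => i; rewrite !mxE; ring.
  by rewrite -sE addmx_sub // -scaleN1r scalemx_sub.
have -> : y - q = (y - x) + (x - q) by apply/rowP => i; rewrite !mxE; ring.
by rewrite addmx_sub // sE.
Qed.

End Planes.


(** * Balanced centers are the deep points *)

Section Center.
Context {R : realType} {d : nat}.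
Variables (S : {fset 'rV[R]_d}) (x : 'rV[R]_d).
Let p : S -> 'rV[R]_d := offset x.

Definition direction (u v : 'rV[R]_d) (t : R) := cos t *: u + sin t *: v.

(** The left factor is the direction at angle [s] after a quarter turn, so the sign tells on which
    side of the line at angle [s] a direction lies. *)
Lemma dot_direction u v s t : orthonormal2 u v ->
  dot (cos s *: v - sin s *: u) (direction u v t) = sin (t - s).
Proof.
by move=> [uu vv uv]; rewrite !dot_lin uu vv uv (dotC v) uv sinB; ring.
Qed.

Lemma direction_neq0 u v t : orthonormal2 u v -> direction u v t != 0.
Proof.
move=> uvP; have [uu vv uv] := uvP; rewrite -dot_gt0 !dot_lin uu vv uv (dotC v) uv.
by have := cos2Dsin2 t; rewrite !expr2; lra.
Qed.

Lemma halfline_direction (v w : 'rV[R]_d) : v != 0 ->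
  halfline x v = halfline x w -> exists2 r, 0 < r & v = r *: w.
Proof.
move=> v0 E; have : halfline x v (x + v) by exists 1; rewrite //= scale1r.
by rewrite E => -[r /= r0 /addrI <-]; exists r.
Qed.

(** Polar coordinates with a signed radius: angles in [0, pi) describe lines instead of
    half-lines. *)
Lemma polar (s t : R) : exists th r,
  [/\ 0 <= th < pi, s = r * cos th & t = r * sin th].
Proof.
have pi0 : 0 < pi :> R := pi_gt0 R.
have upper (s' t' : R) : 0 < t' -> exists th r,
    [/\ 0 <= th < pi, s' = r * cos th & t' = r * sin th].
  move=> t0; pose r := Num.sqrt (s' ^+ 2 + t' ^+ 2).
  have st0 : 0 < s' ^+ 2 + t' ^+ 2 by rewrite ltr_wpDl ?sqr_ge0 ?exprn_gt0.
  have r0 : 0 < r by rewrite sqrtr_gt0.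
  have rr : r ^+ 2 = s' ^+ 2 + t' ^+ 2 by rewrite sqr_sqrtr // ltW.
  have sr1 : -1 <= s' / r <= 1.
    rewrite ler_pdivlMr // ler_pdivrMr // mulN1r mul1r -ler_norml.
    by rewrite -(ger0_norm (ltW r0)) -ler_sqr ?nnegrE // !real_normK ?num_real //; nra.
  have tE : t' = r * sin (acos (s' / r)).
    rewrite sin_acos // (_ : 1 - _ = (t' / r) ^+ 2).
      by rewrite sqrtr_sqr ger0_norm ?divr_ge0 ?ltW // mulrC divfK // lt0r_neq0.
    apply: (mulIf (lt0r_neq0 (exprn_gt0 2 r0))).
    rewrite mulrBl mul1r -!exprMn !divfK ?lt0r_neq0 // rr; ring.
  exists (acos (s' / r)), r; split=> //; last first.
    by rewrite acosK // mulrC divfK // lt0r_neq0.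
  rewrite acos_ge0 //= lt_neqAle acos_lepi // andbT.
  by apply: contraTneq t0 => E; rewrite tE E sinpi mulr0 ltxx.
have [t0|t0|->] := ltrgt0P t.
- exact: upper.
- have [|th [r [thP Es Et]]] := upper (- s) (- t); first by rewrite oppr_gt0.
  by exists th, (- r); split; rewrite // mulNr -?Es -?Et opprK.
- by exists 0, s; rewrite cos0 sin0 mulr1 mulr0 lexx.
Qed.

(** A line turned about [x] in the plane so as to separate the first [i] labels from the others
    makes the sum in [deep_labeling_le] the one with its first [i] terms negated, as
    [alternating_of_splits] requires. *)
Lemma ordered_labels_alternate k (e : 'I_k -> 'rV[R]_d) (P : set 'rV[R]_d) :
    deep p -> labels_odd_lines p e -> (0 < k)%N ->
    appear_in_order P x (plus_then_minus x e) ->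
  odd k /\ exists a : R, (a = 1 \/ a = -1) /\
    forall j, surplus p (e j) = (-1) ^+ j * a.
Proof.
move=> dp eP k0 [u [v [uvP _ [th [th_lt th_2pi thE]]]]].
have [e0 _ _] := eP.
have plusE j : exists2 r, 0 < r & e j = r *: direction u v (th (lshift k j)).
  apply: halfline_direction; first by case: (e0 j).
  by rewrite -thE /plus_then_minus (unsplitK (inl j)).
have minusE j : exists2 r, 0 < r & - e j = r *: direction u v (th (rshift k j)).
  apply: halfline_direction; first by rewrite oppr_eq0; case: (e0 j).
  by rewrite -thE /plus_then_minus (unsplitK (inr j)).
pose al j := th (lshift k j).
have half_turn j : th (rshift k j) = al j + pi.
  have [r r0 Er] := plusE j; have [s s0 Es] := minusE j.
  have E : direction u v (th (rshift k j)) = - (r / s) *: direction u v (al j).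
    apply: (@scalerI _ _ s); first exact: lt0r_neq0.
    by rewrite -Es Er scalerA mulrN mulrCA divff ?lt0r_neq0 // mulr1 scaleNr.
  have [uu vv uv] := uvP; have rs0 : 0 < r / s by rewrite divr_gt0.
  apply: (opposite_angles rs0).
  - by rewrite th_lt ?th_2pi //= ltn_addr.
  - have := congr1 (dot u) E; rewrite !dot_lin uu uv; lra.
  - have := congr1 (dot v) E; rewrite !dot_lin (dotC v) vv uv; lra.
apply: alternating_of_splits => // [j|i ik].
  have [ej0 sj0] := e0 j.
  have bj : balanced S x (e j).
    apply/balancedP => //; apply: le_trans (num_zero_le1 S x).
    exact: deep_surplus.
  by case: (balanced_values ej0 bj) => sj; [rewrite sj eqxx in sj0|left|right].
have [j l jl|j l|phi phiP] := @splitting_angle R k al i.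
- exact: th_lt.
(* Every positive half-line is listed before the negative half-line of [e j], whose angle is
   [al j + pi]. *)
- rewrite -half_turn; apply: th_lt => /=; exact: ltn_addr.
have sgE j : Num.sg (dot (cos phi *: v - sin phi *: u) (e j)) = (-1) ^+ (j < i)%N.
  have [r r0 ->] := plusE j; rewrite dotZr sgrM (gtr0_sg r0) mul1r.
  by rewrite dot_direction ?phiP.
apply: le_trans (num_zero_le1 S x).
have := deep_labeling_le (c := cos phi *: v - sin phi *: u) dp eP.
rewrite (eq_bigr (fun j : 'I_k => (-1) ^+ (j < i)%N * surplus p (e j))).
  by apply=> j; rewrite -sgr_eq0 sgE signr_eq0.
by move=> j _; rewrite sgE mulrC.
Qed.

Lemma deep_center : (2 <= d)%N -> ~~ odd #|` S| -> deep p -> balanced_center S x.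
Proof.
move=> d2 S_even dp.
have bal v : v != 0 -> balanced S x v.
  move=> v0; apply/balancedP => //; apply: le_trans (num_zero_le1 S x).
  exact: deep_surplus.
split=> //; have [k [e eP]] := odd_lines_labeling p.
have [e0 _ eS] := eP.
have [u [v [uv espan]]] : exists u v : 'rV[R]_d, row_free (col_mx u v) /\
    forall i, (e i <= col_mx u v)%MS.
  (* Two labels or more lie in the plane of the first two; with fewer, any plane through the label,
     if there is one, serves. *)
  case: k e eP e0 eS => [|[|k]] e eP e0 eS.
  - have [u [v [uv _]]] := exists_plane_through (0 : 'rV[R]_d) d2.
    by exists u, v; split=> // -[].
  - have [u [v [uv h]]] := exists_plane_through (e ord0) d2.
    by exists u, v; split=> // i; rewrite (ord1 i).
  - pose i1 : 'I_k.+2 := lift ord0 ord0; exists (e ord0), (e i1); split.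
      apply: row_free_col; first by case: (e0 ord0).
      by apply/negP; case: eP => _ eI _ /eI.
    by apply: labels_coplanar => //; apply: num_zero_le1.
exists (plane x u v); split.
- by exists x, u, v.
- move=> w w0 /(odd_balancedP S x w0)[_ /(eS _ w0)[i wi]] y /lineP yw.
  by apply/planeP; apply: submx_trans yw (submx_trans wi _).
(* Without odd lines a generic hyperplane through [x] has equally many points on both sides, so [x]
   in [S] would make the size of [S] odd. *)
- move=> noodd; apply/negP => xS; move/negP: S_even; apply.
  have s0 w : w != 0 -> surplus p w = 0.
    move=> w0; apply/eqP/negPn/negP => sw; apply: noodd; exists w; split=> //.
    by apply/odd_balancedP => //; split=> //; apply: bal.
  have [q|c cP] := @generic_dot R d [seq p y | y <- enum {: S} & p y != 0].
    by move=> /mapP[y]; rewrite mem_filter => /andP[y0 _] ->.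
  have {}cP y : p y != 0 -> dot c (p y) != 0.
    by move=> y0; apply: cP; rewrite map_f // mem_filter y0 mem_enum.
  have : imbalance p c = 0.
    rewrite (imbalanceE c eP) big1 // => i _; rewrite s0 ?mul0r //.
    by case: (e0 i).
  rewrite imbalance_count => /eqP; rewrite subr_eq0 eqr_nat => /eqP posneg.
  have : num_orthogonal p c = 1.
    by rewrite (num_orthogonal_generic cP) num_zeroE xS.
  rewrite num_orthogonal_count => /eqP; rewrite pnatr_eq1 => /eqP orth.
  by rewrite cardfE -(card_sides (fun y => dot c (p y))) posneg orth; lia.
- move=> [w [w0 /(odd_balancedP S x w0)[_ sw]]]; apply: contraT => xS.
  have := le_trans (surplus_norm_ge1 sw) (deep_surplus dp w0).
  by rewrite num_zeroE (negPf xS) ler10.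
- move=> l f l0 /(labelingP _ bal) fP /(ordered_labels_alternate dp fP l0).
  move=> [l_odd [a [a1 fa]]]; split=> //.
  have surE i : npts S (halfline x (f i)) = (npts S (halfline x (- f i)) + 1)%N <->
      (-1) ^+ i * a = 1.
    have [f0 _ _] := fP; have [fi0 _] := f0 i.
    rewrite -fa /p surplus_npts //; split=> [->|/eqP].
      by rewrite natrD addrC addKr.
    by rewrite subr_eq addrC natr1 eqr_nat addn1 => /eqP.
  (* The index [i] stands for the label [i.+1], so [a = 1] puts the surplus on the positive
     half-lines of the odd labels. *)
  case: a1 => aE; [left|right] => i; rewrite surE aE -signr_odd /=.
    by case: (odd i); rewrite ?expr1 ?expr0 mulr1; split=> //; lra.
  by rewrite negbK; case: (odd i); rewrite ?expr1 ?expr0 mulrN1 ?opprK; split=> //; lra.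
Qed.

(** The last clause of [balanced_center] concerns ordered labelings, so one is built by sorting the
    angles in [0, pi) of the odd lines. Along these directions [dot c] is a sinusoid of the angle,
    and the alternating surpluses keep the imbalance at most 1. *)
Lemma center_deep : balanced_center S x -> deep p.
Proof.
move=> [bal [P [Pplane Podd _ xS ordP]]].
have [[w [w0 wodd]]|noodd] := pselect (exists v, v != 0 /\ odd_balanced S x v);
  last first.
  move=> c; have [k [e eP]] := odd_lines_labeling p.
  rewrite (imbalanceE c eP) big1; first by apply: sumr_ge0.
  move=> i _; have [e0 _ _] := eP; have [ei0 si] := e0 i; case: noodd.
  by exists (e i); split=> //; apply/odd_balancedP => //; split=> //; apply: bal.
have Px : P x by apply: (Podd w w0 wodd); apply/lineP; rewrite subrr sub0mx.
have [u [v [uvP PE]]] := plane_frame Pplane Px.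
have dir0 t : direction u v t != 0 by apply: direction_neq0.
have angle z : exists t, p z != 0 -> surplus p (p z) != 0 ->
    0 <= t < pi /\ (p z <= direction u v t)%MS.
  have [z0|z0] := eqVneq (p z) 0; first by exists 0.
  have [sz|sz] := eqVneq (surplus p (p z)) 0; first by exists 0.
  have pz_odd : odd_balanced S x (p z).
    by apply/(odd_balancedP S x z0); split=> //; apply: bal.
  have := Podd _ z0 pz_odd (fsval z); rewrite PE => /(_ _)[|a [b E]].
    by apply/lineP.
  have [t [r [tpi aE bE]]] := polar a b; exists t => _ _; split=> //.
  apply/sub_rVP; exists r; rewrite /p /offset E -[X in X - _]addrA (addrC x) addrK aE bE.
  by rewrite scalerDr !scalerA.
have [ang angP] := choice angle.
pose Th := sort <=%O (undup [seq ang z | z <- enum {: S} & (p z != 0) && (surplus p (p z) != 0)]).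
pose k := size Th; pose al i := nth 0 Th i.
have Th_sorted : sorted <%O Th.
  by rewrite sort_lt_sorted undup_uniq.
have alP i : (i < k)%N -> 0 <= al i < pi /\ surplus p (direction u v (al i)) != 0.
  move=> ik; have : al i \in Th by rewrite mem_nth.
  rewrite mem_sort mem_undup => /mapP[z]; rewrite mem_filter => /andP[/andP[z0 sz] _] ->.
  have [angz zang] := angP z z0 sz; split=> //.
  by rewrite -(surplus_line_eq0 p z0 zang).
have al_lt i j : (i < j < k)%N -> al i < al j.
  by move=> /andP[ij jk]; apply: (sorted_ltn_nth lt_trans) => //; rewrite inE // (ltn_trans ij).
pose e (i : 'I_k) := direction u v (al i).
have eP : labels_odd_lines p e.
  split.
  - by move=> i; split; [exact: dir0 | case: (alP i (ltn_ord i))].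
  - move=> i j ij; apply: val_inj; apply: contrapT => /eqP; rewrite neq_ltn => nij.
    have : dot (cos (al j) *: v - sin (al j) *: u) (e i) = 0.
      by case/sub_rVP: ij => t ->; rewrite dotZr dot_direction // subrr sin0 mulr0.
    rewrite dot_direction // => s0.
    have [/andP[i1 i2] _] := alP i (ltn_ord i).
    have [/andP[j1 j2] _] := alP j (ltn_ord j).
    case/orP: nij => nij.
      have lt : al i < al j by apply: al_lt; rewrite nij ltn_ord.
      have : 0 < sin (al j - al i) by apply: sin_gt0_pi; apply/andP; split; lra.
      by rewrite -opprB sinN s0 oppr0 ltxx.
    have lt : al j < al i by apply: al_lt; rewrite nij ltn_ord.
    have : 0 < sin (al i - al j) by apply: sin_gt0_pi; apply/andP; split; lra.
    by rewrite s0 ltxx.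
  - move=> q q0 sq; have [z zq z0] : exists2 z, (p z <= q)%MS & p z != 0.
      apply: contrapT => noy; move/eqP: sq; apply; apply: big1 => y yq.
      by have [->|y0] := eqVneq (p y) 0; [rewrite dot0r sgr0 | case: noy; exists y].
    have sz : surplus p (p z) != 0 by rewrite (surplus_line_eq0 p z0 zq).
    have zTh : ang z \in Th.
      rewrite mem_sort mem_undup; apply/mapP; exists z => //.
      by rewrite mem_filter mem_enum z0 sz.
    have ik : (index (ang z) Th < k)%N by rewrite index_mem.
    exists (Ordinal ik); rewrite /e /al /= nth_index //.
    have [_] := angP z z0 sz; apply: submx_trans; exact: line_sym.
have k0 : (0 < k)%N.
  have [_ _ eS] := eP; have [_ sw] := (odd_balancedP S x w0).1 wodd.
  by have [i _] := eS w w0 sw; apply: leq_ltn_trans (leq0n i) (ltn_ord i).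
have eL := (labelingP e bal).2 eP.
have order : appear_in_order P x (plus_then_minus x e).
  exists u, v; split=> //.
  exists (fun i => match split i with inl j => al j | inr j => al j + pi end).
  have bnd (j : 'I_k) : 0 <= al j < pi by case: (alP j (ltn_ord j)).
  split.
  - move=> i j; case: (split_ordP i) => i' ->; case: (split_ordP j) => j' -> /=.
    + by move=> ij; apply: al_lt; rewrite ij ltn_ord.
    + by move=> _; have := bnd i'; have := bnd j' => /andP[? ?] /andP[? ?]; lra.
    + by have := ltn_ord j'; lia.
    + by rewrite ltn_add2l ltrD2r => ij; apply: al_lt; rewrite ij ltn_ord.
  - move=> i j; case: (split_ordP i) => i' _; case: (split_ordP j) => j' _;
      have /andP[? ?] := bnd i'; have /andP[? ?] := bnd j'; lra.
  - move=> i; rewrite /plus_then_minus; case: (split i) => j //.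
    by rewrite /e /direction opprD -!scaleNr cosDpi sinDpi.
have [k_odd alt] := ordP k e k0 eL order.
have [a [a1 ea]] : exists a : R, (a = 1 \/ a = -1) /\
    forall i, surplus p (e i) = (-1) ^+ i * a.
  have sE i : surplus p (e i) = 1 <->
      npts S (halfline x (e i)) = (npts S (halfline x (- e i)) + 1)%N.
    rewrite /p surplus_npts; last exact: dir0.
    split=> [/eqP|->].
      by rewrite subr_eq addrC natr1 eqr_nat addn1 => /eqP.
    by rewrite natrD addrC addKr.
  have s1 i : surplus p (e i) = 1 \/ surplus p (e i) = -1.
    have [e0 _ _] := eP; have [ei0 si] := e0 i.
    by case: (balanced_values ei0 (bal _ ei0)) => E; [rewrite E eqxx in si|left|right].
  case: alt => alt; [exists 1|exists (-1)]; (split; first by [left|right]);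
    move=> i; rewrite -signr_odd; have := alt i; rewrite -sE /= => -[h1 h2].
    by case: (odd i) h1 h2 => h1 h2; rewrite ?expr1 ?expr0 mulr1;
      case: (s1 i) => E; rewrite ?E //; [have := h1 E | have := h2 isT; rewrite E].
  by rewrite negbK in h1 h2; case: (odd i) h1 h2 => h1 h2; rewrite ?expr1 ?expr0 ?mulrN1 ?opprK;
    case: (s1 i) => E; rewrite ?E //; [have := h2 isT; rewrite E | have := h1 E].
(* It suffices to bound the imbalance by [num_zero p], which is 1 because [x] is in [S]. *)
move=> c; apply: (@le_trans _ _ (num_zero p)); last first.
  apply: ler_sum => y _; have [->|//] := eqVneq (p y) 0.
  by rewrite dot0r eqxx.
have -> : num_zero p = 1 by rewrite num_zeroE xS //; exists w.
have al_pi j : (j < k)%N -> al j < al 0%N + pi.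
  move=> jk; have [/andP[? ?] _] := alP j jk.
  by have [/andP[? ?] _] := alP 0%N k0; lra.
have /ler_normlP[] := alternating_sum_sinusoid (dot c u) (dot c v) k_odd al_lt al_pi.
rewrite (imbalanceE c eP).
rewrite [X in _ -> _ -> X <= _](eq_bigr (fun i : 'I_k => a * ((-1) ^+ i *
  Num.sg (dot c u * cos (al i) + dot c v * sin (al i))))); last first.
  move=> i _; rewrite ea /e /direction dotDr !dotZr mulrCA mulrA.
  by rewrite (mulrC (cos _)) (mulrC (sin _)).
by rewrite -mulr_sumr; case: a1 => ->; lra.
Qed.

End Center.

(** * The equivalence and the outcome of the game *)

Lemma perfect_noncollinear_deep (R : realType) (d : nat) (S : {fset 'rV[R]_d}) x :
  ~~ odd #|` S| -> S = fset0 \/ ~ collinear S ->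
  perfect_hyperplanes_contain S x -> deep (@offset R d S x).
Proof.
move=> S_even Scol /perfect_offsets pz.
case: Scol => [S0|ncol].
  by apply/deepP => c; rewrite eq_card0 // => y; have := fsvalP y; rewrite {2}S0 inE.
apply: perfect_deep pz => [|q v v0]; first by rewrite -cardfE.
apply: contrapT => H; apply: ncol; exists (q + x), v; split=> // y yS.
apply: contrapT => ynot; apply: H; exists [` yS]%fset => -[t /= E]; apply: ynot.
by exists t => //; rewrite addrAC -E subrK.
Qed.

(** Depth of [x] links all the conditions; the case assumption on [S] serves to recover depth from
    the perfect hyperplanes. *)
Theorem theorem3 (R : realType) (d : nat) (S : {fset 'rV[R]_d}) :
  (2 <= d)%N -> ~~ odd #|` S|%fset ->
  [/\ S = fset0 \/ ~ collinear S ->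
        forall x : 'rV[R]_d,
          perfect_hyperplanes_contain S x <-> balanced_center S x,
      forall x : 'rV[R]_d,
        balanced_center S x -> perfect_hyperplanes_contain S x,
      alice_wins S <-> exists x : 'rV[R]_d, balanced_center S x &
      forall x : 'rV[R]_d, balanced_center S x -> winning S x].
Proof.
move=> d2 S_even.
have contain x : balanced_center S x -> perfect_hyperplanes_contain S x.
  by move=> /center_deep /deep_perfect /perfect_offsets.
have win x : balanced_center S x -> winning S x.
  by move=> /center_deep /winning_deep.
split=> // [Scol x|].
  split=> [/(perfect_noncollinear_deep S_even Scol)|]; last exact: contain.
  exact: deep_center.
split=> -[x]; last by move=> /win; exists x.
by move=> /winning_deep /(deep_center d2 S_even); exists x.
Qed.
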